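(* Let $n,T,d\ge 1$ be integers with $T\ge 3$. For each sample $i\in\{1,\dots,n\}$ let $e^{(i)}_1,\dots,e^{(i)}_T\in\mathbb{R}^{d}$ be context tokens, let $y_i\in\{1,\dots,T-1\}$ be the match index, let the query be $q^{(i)}=e^{(i)}_{y_i}$ (exact match) and let the target be $e^{(i)}_{y_i+1}$ (exact copy). For $w\in\mathbb{R}^{d^2}$ (the flattening of a matrix $W\in\mathbb{R}^{d\times d}$, with the flattening chosen so that $e^\top W q = w^\top\operatorname{flatten}(e\,q^\top)$) set $x_{i,t}:=\operatorname{flatten}(e^{(i)}_t q^{(i)\top})$ for $t=1,\dots,T-1$, and define attention weights $a^{(i)}_1(w)=0$ and $$a^{(i)}_{t+1}(w)=\frac{\exp(w^\top x_{i,t})}{\sum_{s=1}^{T-1}\exp(w^\top x_{i,s})},\qquad t=1,\dots,T-1.$$ Define the loss $$\mathrm{MSE}(w)=\sum_{i=1}^n\frac12\Big\|\sum_{t=1}^T a^{(i)}_t(w)\,e^{(i)}_t-e^{(i)}_{y_i+1}\Big\|^2,$$ and run gradient descent $w(\tau+1)=w(\tau)-\eta\nabla\mathrm{MSE}(w(\tau))$ with a fixed step size $\eta>0$. For $t\in\{1,\dots,T-1\}\setminus\{y_i\}$ let $\tilde x_{i,t}:=x_{i,y_i}-x_{i,t}$ and $d_{i,t}:=e^{(i)}_{t+1}-e^{(i)}_{y_i+1}$, and let $$h_{i,t}(w):=\sum_{s\neq y_i}\langle d_{i,t},d_{i,s}\rangle\,\frac{a^{(i)}_{s+1}(w)}{1-a^{(i)}_{y_i+1}(w)}.$$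 Assume: (A1) the hard-margin problem $\min_w\frac12\|w\|^2$ subject to $w^\top\tilde x_{i,t}\ge 1$ for all $i$ and all $t\neq y_i$ is feasible; let $\hat w$ be its (unique) solution and $\mathcal I_{SV}:=\{(i,t):\hat w^\top\tilde x_{i,t}=1\}$, $\mathcal I_{SV}(i):=\{s:(i,s)\in\mathcal I_{SV}\}$; (A2) the vectors $\{\tilde x_{i,t}:(i,t)\in\mathcal I_{SV}\}$ are linearly independent; write $\hat w=\sum_{(i,t)\in\mathcal I_{SV}}\alpha_{i,t}\tilde x_{i,t}$ for the (KKT) coefficients $\alpha_{i,t}$; (A3) for every $i$, $e^{(i)}_{y_i+1}$ does not lie in the convex hull of $\{e^{(i)}_{t+1}:t\in\{1,\dots,T-1\}, t\neq y_i\}$; (A4) for every $i$ and all $t,s\neq y_i$, $\langle d_{i,t},d_{i,s}\rangle>0$; (A5) $\mathrm{MSE}(w(\tau))\to 0$ as $\tau\to\infty$; (A6) $\sum_{\tau=0}^\infty\|\nabla\mathrm{MSE}(w(\tau))\|^2<\infty$; (A7) for all $(i,t)$ the limit $h^\infty_{i,t}:=\lim_{\tau\to\infty}h_{i,t}(w(\tau))$ exists and $\sum_{\tau\ge1}\tau^{-1}|h_{i,t}(w(\tau))-h^\infty_{i,t}|<\infty$; (A8) let $\tilde w$ be the unique vector in $\operatorname{span}\{\tilde x_{i,t}:(i,t)\in\mathcal I_{SV}\}$ satisfying, for all $(i,t)\in\mathcal I_{SV}$, $$\eta\,h^\infty_{i,t}\,e^{-\tilde w^\top\tilde x_{i,t}}\sum_{s\in\mathcal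 I_{SV}(i)}e^{-\tilde w^\top\tilde x_{i,s}}=\tfrac12\alpha_{i,t};$$ set $p_{i,t}:=e^{-\tilde w^\top\tilde x_{i,t}}$, $r(\tau):=w(\tau)-\tfrac12\log(\tau)\,\hat w-\tilde w$, $u_{i,t}(\tau):=\langle r(\tau),\tilde x_{i,t}\rangle$, $H_{i,t,s}(\tau):=h^\infty_{i,t}u_{i,t}(\tau)+h^\infty_{i,s}u_{i,s}(\tau)$ and $U_{i,t,s}(\tau):=u_{i,t}(\tau)+u_{i,s}(\tau)$. Then there exists $\varepsilon\in(0,1/2)$ such that for all sufficiently large $\tau$ and all $i$, $$\sum_{\substack{s,t\in\mathcal I_{SV}(i),\ s\neq t\\ \operatorname{sign}(H_{i,t,s}(\tau))\neq\operatorname{sign}(U_{i,t,s}(\tau))}}p_{i,t}p_{i,s}|H_{i,t,s}(\tau)|\,|e^{-U_{i,t,s}(\tau)}-1|\le\varepsilon\sum_{\substack{s,t\in\mathcal I_{SV}(i),\ s\neq t}}p_{i,t}p_{i,s}|H_{i,t,s}(\tau)|\,|e^{-U_{i,t,s}(\tau)}-1|;$$ (A9) there exists $g:\mathbb N\to\mathbb R$ with $\sum_\tau g(\tau)\tau^{-1}<\infty$ such that for all $i$ and $\tau$, $$\sum_{s\notin\mathcal I_{SV}(i),\,s\neq y_i}\exp(-w(\tau)^\top\tilde x_{i,s})\le g(\tau)\sum_{s\in\mathcal I_{SV}(i)}\exp(-w(\tau)^\top\tilde x_{i,s}).$$ Then $\|w(\tau)\|\sim\frac{\|\hat w\|}{2}\log(\tau)$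 and $\frac{w(\tau)}{\|w(\tau)\|}\to\frac{\hat w}{\|\hat w\|}$ as $\tau\to\infty$.
   Context: This is gradient descent on the merged key–query matrix $W$ of a single-query attention head whose keys are shifted by one position (attention score of position $t-1$ determines the weight of token $t$) and whose value map is the identity, trained with squared loss on exact match-and-copy data. ''Sign'' denotes the real sign function. In (A8) the defining equations for $\tilde w$ are required to have a unique solution in the stated span (this is the case when the relevant $h^\infty_{i,t}$ and $\alpha_{i,t}$ are positive). *)

(* Defs.v *)
From HB Require Import structures.
From mathcomp Require Import all_boot all_order all_algebra.
From mathcomp Require Import all_classical all_reals all_analysis.
Set Implicit Arguments. Unset Strict Implicit. Unset Printing Implicit Defensive.
Import Order.TTheory GRing.Theory Num.Theory.
Import numFieldNormedType.Exports.
Local Open Scope ring_scope.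

Definition dotv (R : realType) (m : nat) (u v : 'rV[R]_m) : R :=
  \sum_(k < m) u 0 k * v 0 k.
Definition normv (R : realType) (m : nat) (u : 'rV[R]_m) : R :=
  Num.sqrt (dotv u u).

Definition is_gradient (R : realType) (m : nat) (f : 'rV[R]_m -> R)
  (x g : 'rV[R]_m) : Prop :=
  forall k : 'I_m, is_derive x (delta_mx 0 k : 'rV[R]_m) f (g 0 k).

Section Model.
Variable R : realType.
(* n samples, T tokens per context, dimension d; tokens are indexed 1..T
   (values of e i t for t outside 1..T are never used). *)
Variables (n d T : nat) (e : 'I_n -> nat -> 'rV[R]_d) (y : 'I_n -> nat).

(* x_{i,t} = flatten (e_t q^T), with q = e_{y_i}; dotv w (xt i t) = e_t^T W q *)
Definition xt (i : 'I_n) (t : nat) : 'rV[R]_(d * d) :=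
  mxvec ((e i t)^T *m e i (y i)).

(* softmax weight of position t (1 <= t <= T-1); this is a_{t+1}(w) *)
Definition attn (w : 'rV[R]_(d * d)) (i : 'I_n) (t : nat) : R :=
  expR (dotv w (xt i t)) / \sum_(1 <= s < T) expR (dotv w (xt i s)).

Definition aw (w : 'rV[R]_(d * d)) (i : 'I_n) (t : nat) : R :=
  if (t <= 1)%N then 0 else attn w i t.-1.

Definition attn_out (w : 'rV[R]_(d * d)) (i : 'I_n) : 'rV[R]_d :=
  \sum_(1 <= t < T.+1) aw w i t *: e i t.

Definition MSE (w : 'rV[R]_(d * d)) : R :=
  \sum_(i < n) 2^-1 * normv (attn_out w i - e i (y i).+1) ^+ 2.

Definition xtil (i : 'I_n) (t : nat) : 'rV[R]_(d * d) := xt i (y i) - xt i t.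
Definition dd (i : 'I_n) (t : nat) : 'rV[R]_d := e i t.+1 - e i (y i).+1.

Definition hh (w : 'rV[R]_(d * d)) (i : 'I_n) (t : nat) : R :=
  \sum_(1 <= s < T | s != y i)
     dotv (dd i t) (dd i s) * (attn w i s / (1 - attn w i (y i))).

Definition margin_feasible (w : 'rV[R]_(d * d)) : Prop :=
  forall (i : 'I_n) (t : nat), (1 <= t < T)%N -> t != y i ->
    1 <= dotv w (xtil i t).

Definition hard_margin_solution (wh : 'rV[R]_(d * d)) : Prop :=
  margin_feasible wh /\
  forall w, margin_feasible w -> normv wh ^+ 2 / 2 <= normv w ^+ 2 / 2.

Definition isSV (wh : 'rV[R]_(d * d)) (i : 'I_n) (t : nat) : bool :=
  [&& (1 <= t < T)%N, t != y i & dotv wh (xtil i t) == 1].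

Definition SVcomb (wh : 'rV[R]_(d * d)) (c : 'I_n -> nat -> R) : 'rV[R]_(d * d) :=
  \sum_(i < n) \sum_(1 <= t < T | isSV wh i t) c i t *: xtil i t.

Definition in_SVspan (wh v : 'rV[R]_(d * d)) : Prop :=
  exists c : 'I_n -> nat -> R, v = SVcomb wh c.

Definition wtil_eqs (eta : R) (hinf : 'I_n -> nat -> R)
  (alpha : 'I_n -> nat -> R) (wh v : 'rV[R]_(d * d)) : Prop :=
  forall (i : 'I_n) (t : nat), isSV wh i t ->
    eta * hinf i t * expR (- dotv v (xtil i t)) *
      (\sum_(1 <= s < T | isSV wh i s) expR (- dotv v (xtil i s)))
    = 2^-1 * alpha i t.

Definition pp (wt : 'rV[R]_(d * d)) (i : 'I_n) (t : nat) : R :=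
  expR (- dotv wt (xtil i t)).

Definition rr (w : nat -> 'rV[R]_(d * d)) (wh wt : 'rV[R]_(d * d)) (tau : nat)
  : 'rV[R]_(d * d) :=
  w tau - (2^-1 * ln (tau%:R : R)) *: wh - wt.

Definition uu w wh wt tau i t : R := dotv (rr w wh wt tau) (xtil i t).

Definition HH (hinf : 'I_n -> nat -> R) w wh wt tau i t s : R :=
  hinf i t * uu w wh wt tau i t + hinf i s * uu w wh wt tau i s.

Definition UU w wh wt tau i t s : R := uu w wh wt tau i t + uu w wh wt tau i s.

Definition A8term hinf w wh wt tau i t s : R :=
  pp wt i t * pp wt i s * `|HH hinf w wh wt tau i t s|
  * `|expR (- UU w wh wt tau i t s) - 1|.

End Model.

(* Main.v *)
(* Write z_t = exp(-<w, xtil_t>) and S = sum_t z_t for each sample. The softmax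
   weight of the match is 1/(1+S), and minus the gradient is the sum over samples
   and over t of z_t S kappa_t xtil_t with kappa_t = h_t + O(S), h_t bounded above
   and below by (A4), and S -> 0 by (A5). Put r = w - (1/2) ln(tau) wh - wt. By the
   equations for wt, 1 + |r|^2 grows in one step by at most a summable
   relative amount: if S is large compared with tau^(-1/2) the contribution of
   the sample to <r(tau+1) - r(tau), r(tau)> is nonpositive, and otherwise it
   differs by a summable error from
   (1/tau) sum h_t p_t p_s u_t (exp(-(u_t + u_s)) - 1), which after symmetrisation
   in (t, s) is nonpositive thanks to the sign condition (A8). Hence r is bounded,
   so w = (1/2) ln(tau) wh + O(1). *)
Require Import Defs.
From HB Require Import structures.
From mathcomp Require Import all_boot all_order all_algebra.
From mathcomp Require Import all_classical all_reals all_analysis.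
From mathcomp Require Import ring lra.
Set Implicit Arguments.
Unset Strict Implicit.
Unset Printing Implicit Defensive.
Import Order.TTheory GRing.Theory Num.Theory.
Import numFieldNormedType.Exports.
Local Open Scope ring_scope.
Local Open Scope classical_set_scope.

(** * Summable sequences *)

(** The obstacle is that (A5) gives S -> 0 without a rate, so nothing is known in advance about the
    size of r, and no expansion around r = 0 is available. Every estimate has to hold for arbitrary
    u_t. This works because the two signs of u_t behave differently: a positive u_t enters only
    through x exp(-x) <= 1, while a negative one, however large, has the favourable sign in the
    gradient term because kappa_t > 0. The equations for wt express a cancellation. With r = 0, the
    leading part of one gradient step is (eta/tau) times the sum of h_t p_t (sum_s p_s) xtil_t over
    the support vectors; by these equations it equals wh/(2 tau). The schedule (1/2) ln(tau) wh
    moves by the same amount up to O(tau^(-2)), which is the comparison of 1/k with the increment of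
    ln. What survives is the dependence on r, plus errors of four kinds: the two hypothesised
    1/tau-weighted series, powers tau^(-a) with a > 1, and the squared step. *)

Lemma ln_succ_sub (R : realType) (k : nat) : (0 < k)%N ->
  0 <= (k%:R : R)^-1 - (ln k.+1%:R - ln k%:R) <= k%:R^-1 ^+ 2.
Proof.
move=> k0; have k0' : 0 < k%:R :> R by rewrite ltr0n.
have k1' : 0 < k.+1%:R :> R by rewrite ltr0n.
rewrite -[k.+1%:R]natr1 in k1' *; move: k0' k1'; move: (k%:R : R) => x x0 x1.
have up : ln (x + 1) - ln x <= x^-1.
  have -> : ln (x + 1) - ln x = ln (1 + x^-1).
    by rewrite -ln_div ?posrE//; congr ln; field; rewrite gt_eqF.
  by apply: le_ln1Dx; rewrite (@lt_trans _ _ 0) ?invr_gt0//; lra.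
have lo : (x + 1)^-1 <= ln (x + 1) - ln x.
  have -> : ln (x + 1) - ln x = - ln (1 + - (x + 1)^-1).
    rewrite -[LHS]opprB -ln_div ?posrE//; congr (- ln _); field; rewrite gt_eqF//.
  rewrite lerNr; apply: le_ln1Dx; rewrite ltrN2 invf_lt1//; lra.
rewrite subr_ge0 up/=; apply: (@le_trans _ _ (x^-1 - (x + 1)^-1)).
  by rewrite lerD2l lerN2.
have -> : x^-1 - (x + 1)^-1 = x^-1 * (x + 1)^-1.
  by field; rewrite !gt_eqF.
by rewrite expr2 ler_wpM2l ?invr_ge0 ?(ltW x0)// lef_pV2 ?posrE//; lra.
Qed.

Section Summability.
Variable R : realType.
Implicit Types u v : nat -> R.

(** Bounded partial sums replace convergence: closure under sums and scaling is then immediate, and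
    the growth lemma consumes exactly such a bound. *)
Definition nneg_summable u :=
  (forall n, 0 <= u n) /\ exists M, forall n, \sum_(0 <= k < n) u k <= M.

Lemma nneg_summableD u v : nneg_summable u -> nneg_summable v ->
  nneg_summable (fun k => u k + v k).
Proof.
move=> [u0 [M uM]] [v0 [N vN]]; split=> [n|]; first exact: addr_ge0.
by exists (M + N) => n; rewrite big_split lerD.
Qed.

Lemma nneg_summableZ c u : 0 <= c -> nneg_summable u ->
  nneg_summable (fun k => c * u k).
Proof.
move=> c0 [u0 [M uM]]; split=> [n|]; first exact: mulr_ge0.
by exists (c * M) => n; rewrite -mulr_sumr ler_wpM2l.
Qed.

Lemma nneg_summable_sum (I : Type) (r : seq I) (P : pred I) (F : I -> nat -> R) :
  (forall i, P i -> nneg_summable (F i)) ->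
  nneg_summable (fun k => \sum_(i <- r | P i) F i k).
Proof.
move=> FP; split=> [n|].
  by apply: sumr_ge0 => i /FP[].
elim: r => [|i r [M IH]].
  by exists 0 => n; under eq_bigr do rewrite big_nil; rewrite big1.
have [Pi|Pi] := boolP (P i).
  have [_ [N FN]] := FP _ Pi; exists (N + M) => n.
  by under eq_bigr do rewrite big_cons Pi; rewrite big_split lerD.
by exists M => n; under eq_bigr do rewrite big_cons (negbTE Pi).
Qed.

Lemma nneg_summable_series u : (forall n, 0 <= u n) ->
  cvg (series u @ \oo) -> nneg_summable u.
Proof.
move=> u0 cu; split=> //; exists (limn (series u)) => n.
have := nondecreasing_cvgn_le (nondecreasing_series (fun k _ _ => u0 k)) cu n.
by rewrite seriesEnat.
Qed.

(** The series of k^(-a), by telescoping: with b = a - 1, (k+1)^(-a) <= (k^(-b) - (k+1)^(-b)) /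
    b. *)
Lemma nneg_summable_ln (a : R) : 1 < a ->
  nneg_summable (fun k => expR (- (a * ln k%:R))).
Proof.
move=> a1; split=> [n|]; first exact: expR_ge0.
set b := a - 1; have b0 : 0 < b by rewrite subr_gt0.
pose f (k : nat) : R := expR (- (b * ln k%:R)).
have step k : (0 < k)%N ->
    expR (- (a * ln (k.+1)%:R)) <= b^-1 * (f k - f k.+1).
  move=> k0; rewrite -(ler_pM2l b0) mulrA divff ?gt_eqF// mul1r.
  have k0' : 0 < k%:R :> R by rewrite ltr0n.
  have k1' : 0 < k.+1%:R :> R by rewrite ltr0n.
  have lnb : k.+1%:R^-1 <= ln k.+1%:R - ln k%:R :> R.
    have := @le_ln1Dx R (- k.+1%:R^-1).
    have -> : 1 + - k.+1%:R^-1 = k%:R / k.+1%:R :> R.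
      by rewrite -natr1; field; rewrite natr1 pnatr_eq0.
    rewrite ltrN2 invf_lt1// ltr1n ltnS k0 => /(_ isT).
    by rewrite ln_div ?posrE// -lerN2 opprK opprB.
  have -> : expR (- (a * ln k.+1%:R)) = f k.+1 / k.+1%:R :> R.
    rewrite -[X in _ / X]lnK ?posrE// -expRN -expRD /b; congr expR; ring.
  have -> : f k - f k.+1 =
      f k.+1 * (expR (b * (ln k.+1%:R - ln k%:R)) - 1).
    by rewrite mulrBr mulr1 -expRD; congr (expR _ - _); ring.
  rewrite mulrCA; apply: ler_wpM2l; first exact: expR_ge0.
  rewrite lerBrDl; apply: le_trans (expR_ge1Dx _).
  by rewrite lerD2l ler_pM2l.
have bound n : \sum_(0 <= k < n) expR (- (a * ln (k.+2)%:R)) <=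
    b^-1 * (f 1%N - f n.+1).
  elim: n => [|n IH]; first by rewrite big_geq// subrr mulr0.
  rewrite big_nat_recr//=; apply: le_trans (lerD IH (step n.+1 _)) _ => //.
  by rewrite -mulrDr; apply: ler_wpM2l; [rewrite invr_ge0 ltW|lra].
(* The 2 pays for the indices 0 and 1: both terms equal 1, since [ln 0] is 0 by convention. *)
exists (2 + b^-1 * f 1%N) => n.
have fb0 : 0 <= b^-1 * f 1%N by rewrite mulr_ge0 ?expR_ge0// invr_ge0 ltW.
case: n => [|[|n]]; first by rewrite big_geq//; lra.
  by rewrite big_nat1 ln0// mulr0 oppr0 expR0; lra.
rewrite big_nat_recl//= big_nat_recl//= ln0// ln1 mulr0 oppr0 expR0.
have := bound n; have : 0 <= b^-1 * f n.+1 by rewrite mulr_ge0 ?expR_ge0// invr_ge0 ltW.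
by rewrite mulrBr; lra.
Qed.

(** Discrete Gronwall: 1 + x <= exp x turns the product of the growth factors into the exponential
    of a bounded sum. *)
Lemma perturbed_nonincreasing_bounded (V gam : nat -> R) (k0 : nat) :
  (forall k, 0 <= V k) -> nneg_summable gam ->
  (forall k, (k0 <= k)%N -> V k.+1 <= (1 + gam k) * V k) ->
  exists M, forall k, (k0 <= k)%N -> V k <= M.
Proof.
move=> V0 [gam0 [M gamM]] Vstep; exists (V k0 * expR M) => k k0k.
apply: (@le_trans _ _ (V k0 * expR (\sum_(0 <= j < k) gam j))); last first.
  by apply: ler_wpM2l => //; rewrite ler_expR.
elim: k k0k => [|k IH].
  by rewrite leqn0 => /eqP ->; rewrite big_geq// expR0 mulr1.
rewrite leq_eqVlt => /predU1P[<-|].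
  by rewrite ler_peMr// -expR0 ler_expR sumr_ge0.
rewrite ltnS => k0k; apply: le_trans (Vstep _ k0k) _.
rewrite big_nat_recr//= expRD mulrA [leRHS]mulrC; apply: ler_pM => //.
- by have := gam0 k; lra.
- exact: expR_ge1Dx.
- exact: IH.
Qed.

Lemma pos_family_bounds (I : eqType) (s : seq I) (P : pred I) (f : I -> R) :
  (forall i, P i -> 0 < f i) ->
  exists c, exists2 C, 0 < c <= C &
    forall i, i \in s -> P i -> c <= f i <= C.
Proof.
move=> fP; elim: s => [|i s [c [C /andP[c0 cC] IH]]].
  by exists 1, 1 => //; rewrite ltr01 lexx.
have [Pi|Pi] := boolP (P i); last first.
  exists c, C => [|j]; first by rewrite c0.
  by rewrite inE => /predU1P[->|/IH//]; rewrite (negbTE Pi).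
exists (Num.min c (f i)), (Num.max C (f i)) => [|j].
  by rewrite lt_min c0 fP//= ge_min le_max cC.
rewrite inE => /predU1P[->|jB Pj]; first by rewrite ge_min le_max lexx !orbT.
by have /andP[? ?] := IH _ jB Pj; rewrite ge_min le_max; apply/andP; split; apply/orP; left.
Qed.

End Summability.

(** * One-step drift of a single sample *)

Section Drift.
Variable R : realType.

Lemma expRN_mul_le1 (x : R) : expR (- x) * x <= 1.
Proof.
rewrite expRN mulrC ler_pdivrMr ?expR_gt0// mul1r.
by have := expR_ge1Dx x; lra.
Qed.

(* One sample at one time tau: A is the set of positions t <> y_i, Q the support
   vectors, L = tau^(-1/2), u_t = <r(tau), xtil_t>, and q_t exp(-u_t) is
   exp(-<w(tau), xtil_t>). *)
Variables (r : seq nat) (A Q : pred nat) (p h : nat -> R) (c C : R).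
Hypotheses (c0 : 0 < c) (cC : c <= C).
Hypothesis QA : forall t, Q t -> A t.
Hypothesis p0 : forall t, A t -> 0 < p t.
Hypothesis h0 : forall t, Q t -> 0 <= h t <= C.

Variables (L : R) (q kap u : nat -> R).
Hypothesis L0 : 0 < L.
Hypothesis q0 : forall t, A t -> 0 < q t.
Hypothesis qL : forall t, A t -> q t <= L * p t.
Hypothesis qQ : forall t, Q t -> q t = L * p t.
Hypothesis kapP : forall t, A t -> c <= kap t <= C.

Let z t := q t * expR (- u t).
Let P := \sum_(t <- r | A t) p t.
Let S := \sum_(t <- r | A t) z t.

Let z0 t : A t -> 0 < z t.
Proof. by move=> /q0 ?; rewrite mulr_gt0 ?expR_gt0. Qed.

Let neg t : R := Num.max (- u t) 0.
Let neg0 t : 0 <= neg t. Proof. by rewrite le_max lexx orbT. Qed.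

Lemma le_sum_subpred (F : nat -> R) : (forall t, A t -> 0 <= F t) ->
  \sum_(t <- r | Q t) F t <= \sum_(t <- r | A t) F t.
Proof.
move=> F0; rewrite [leRHS](bigID Q)/=.
under [X in _ <= X + _]eq_bigl => t.
  have -> : A t && Q t = Q t by apply/andb_idl/QA.
  over.
by rewrite lerDl sumr_ge0// => t /andP[/F0].
Qed.

(* When S is much larger than L = tau^(-1/2), most of S comes from positions
   with u_t very negative; these push r back and beat everything else. *)
Lemma drift_far :
  expR 1 * P + 2 * C * P / c <= S / L ->
  \sum_(t <- r | A t) z t * S * kap t * u t
  <= L ^+ 2 * ((\sum_(t <- r | Q t) h t * p t * u t) * \sum_(t <- r | Q t) p t).
Proof.
move=> SL.
have [[c_gt0 c_leC] L_gt0] := (c0, cC, L0).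
have C0 : 0 < C := lt_le_trans c0 cC.
have P0 : 0 <= P by apply: sumr_ge0 => t /p0/ltW.
have S0 : 0 <= S by apply: sumr_ge0 => t /z0/ltW.
(* [N] measures the restoring force of the positions with negative u_t. Both sides of the goal are
   compared with it. *)
pose N := \sum_(t <- r | A t) z t * neg t.
have N0 : 0 <= N by apply: sumr_ge0 => t /z0/ltW ?; rewrite mulr_ge0.
have lhsP : \sum_(t <- r | A t) z t * S * kap t * u t <= C * S * (L * P) - c * S * N.
  clearbody S; rewrite /P /N !mulr_sumr -sumrB; apply: ler_sum => t At.
  have /andP[k1 k2] := kapP At; have zt := z0 At.
  have qt := q0 At; have qLt := qL At.
  rewrite /neg; have [u0|u0] := leP (- u t) 0.
    rewrite !mulr0 subr0.
    have : z t * u t <= L * p t.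
      by apply: le_trans qLt; rewrite /z -mulrA ler_piMr ?expRN_mul_le1// ltW.
    move=> zu; have -> : z t * S * kap t * u t = S * kap t * (z t * u t) by ring.
    have zu0 : 0 <= z t * u t by rewrite mulr_ge0 ?(ltW zt)//; lra.
    apply: ler_pM => //; first by rewrite mulr_ge0//; lra.
    by rewrite mulrC ler_wpM2r.
  have -> : C * S * (L * p t) - c * S * (z t * - u t) =
    C * S * (L * p t) + c * (z t * S * u t) by ring.
  have -> : z t * S * kap t * u t = kap t * (z t * S * u t) by ring.
  have : kap t * (z t * S * u t) <= c * (z t * S * u t).
    by apply: ler_wnM2r => //; rewrite mulr_ge0_le0 ?mulr_ge0 ?(ltW zt)//; lra.
  have : 0 <= C * S * (L * p t) by rewrite !mulr_ge0 // ?ltW// p0.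
  lra.
have rhsP : - (L * C * P * N) <=
  L ^+ 2 * ((\sum_(t <- r | Q t) h t * p t * u t) * \sum_(t <- r | Q t) p t).
  pose M := \sum_(t <- r | Q t) z t * neg t.
  have MN : M <= N.
    by apply: le_sum_subpred => t /z0/ltW ?; rewrite mulr_ge0.
  pose P' := \sum_(t <- r | Q t) p t.
  have P'P : P' <= P by apply: le_sum_subpred => t /p0/ltW.
  have P'0 : 0 <= P' by apply: sumr_ge0 => t /QA/p0/ltW.
  have M0 : 0 <= M by apply: sumr_ge0 => t /QA/z0/ltW ?; rewrite mulr_ge0.
  have X : - (C * M) <= L * \sum_(t <- r | Q t) h t * p t * u t.
    rewrite !mulr_sumr -sumrN; apply: ler_sum => t Qt.
    have /andP[h1 h2] := h0 Qt; have At := QA Qt.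
    rewrite /neg; have [u0|u0] := leP (- u t) 0.
      by rewrite !mulr0 oppr0 !mulr_ge0 ?(ltW L0) ?(ltW (p0 At))//; lra.
    have zL : L * p t <= z t.
      by rewrite -qQ// /z ler_peMr ?(ltW (q0 At))// -[leLHS]expR0 ler_expR ltW.
    have -> : L * (h t * p t * u t) = - (h t * (L * p t * - u t)) by ring.
    rewrite lerN2; apply: ler_pM => //.
      by rewrite !mulr_ge0 // ?ltW// p0.
    by rewrite ler_wpM2r// ltW.
  have -> : L ^+ 2 * ((\sum_(t <- r | Q t) h t * p t * u t) * P') =
    (L * P') * (L * \sum_(t <- r | Q t) h t * p t * u t) by ring.
  apply: le_trans (ler_wpM2l _ X); last by rewrite mulr_ge0 // ?ltW.
  rewrite mulrN lerN2.
  have -> : L * C * P * N = (L * P) * (C * N) by ring.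
  by apply: ler_pM; rewrite ?mulr_ge0 ?ler_wpM2l ?(ltW L0) ?(ltW C0).
(* Positions with u_t >= -1 have z_t <= e q_t <= e L p_t; for the others z_t <= z_t |u_t|. So a
   large S forces a large [N]. *)
have NS : S <= expR 1 * (L * P) + N.
  rewrite /S /P /N !mulr_sumr -big_split/=; apply: ler_sum => t At.
  have zt := z0 At; have qt := q0 At; have qLt := qL At.
  have [u1|u1] := leP (-1) (u t).
    apply: le_trans (_ : expR 1 * (L * p t) <= _); last first.
      by rewrite lerDl mulr_ge0 // ?ltW.
    rewrite mulrC /z; apply: ler_pM; rewrite ?(ltW qt) ?expR_ge0//.
    by rewrite ler_expR; lra.
  have : z t <= z t * neg t.
    by rewrite ler_peMr ?(ltW zt)// /neg le_max; apply/orP; left; lra.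
  have : 0 < expR 1 * (L * p t) by rewrite !mulr_gt0 ?expR_gt0 ?p0.
  lra.
apply: le_trans lhsP _; apply: le_trans rhsP.
(* It remains to see C L P (S + N) <= c S N. With X = 2 C P / c, both N >= X L and S >= X L hold;
   each bounds one of the two terms on the left by c S N / 2, hence the factor 2 in the
   threshold. *)
have SL' : (expR 1 * P + 2 * C * P / c) * L <= S by rewrite -ler_pdivlMr.
have e1 : 2 * C * P / c * c = 2 * C * P by rewrite divfK// gt_eqF.
set X := 2 * C * P / c in SL' e1.
have X0 : 0 <= X by rewrite /X !mulr_ge0 ?invr_ge0 ?(ltW c0) ?(ltW C0).
have a1 : X * L <= N by lra.
have a2 : X * L <= S.
  have : 0 <= expR 1 * P * L by rewrite !mulr_ge0// ltW.
  lra.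
have b1 : c * (S * (X * L)) <= c * (S * N).
  by rewrite ler_wpM2l ?(ltW c0)// ler_wpM2l.
have b2 : c * (N * (X * L)) <= c * (N * S).
  by rewrite ler_wpM2l ?(ltW c0)// ler_wpM2l.
have d1 : c * (S * (X * L)) = 2 * C * P * (L * S) by rewrite -e1; ring.
have d2 : c * (N * (X * L)) = 2 * C * P * (L * N) by rewrite -e1; ring.
lra.
Qed.

Let SQ := \sum_(t <- r | Q t) z t.
Let SN := \sum_(t <- r | ~~ Q t && A t) z t.

(* When S = O(L), each z_t |u_t| is O(L) on Q, so all deviations from the
   limiting dynamics are summable; the last hypothesis is the sign of the
   limiting dynamics. *)
Lemma drift_near (K B g D : R) :
  B = \sum_(t <- r | Q t) (p t + K ^+ 2 / p t) -> 0 <= g ->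
  S <= K * L -> SN <= g * SQ ->
  (forall t, Q t -> `|kap t - h t| <= D) -> 0 <= D ->
  \sum_(t <- r | Q t) h t * p t * u t * (\sum_(s <- r | Q s) p s * (expR (- (u t + u s)) - 1)) <= 0 ->
  \sum_(t <- r | A t) z t * S * kap t * u t
  <= L ^+ 2 * ((\sum_(t <- r | Q t) h t * p t * u t) * \sum_(t <- r | Q t) p t)
   + K * B * D * L ^+ 2 + K * B * C * g * L ^+ 2
   + K * C * (L * \sum_(t <- r | ~~ Q t && A t) q t).
Proof.
move=> BE g0 SKL SNg kD D0 main.
have [[c_gt0 c_leC] L_gt0] := (c0, cC, L0).
have C0 : 0 < C := lt_le_trans c0 cC.
have S0 : 0 <= S by apply: sumr_ge0 => t /z0/ltW.
have SQ0 : 0 <= SQ by apply: sumr_ge0 => t /QA/z0/ltW.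
have SN0 : 0 <= SN by apply: sumr_ge0 => t /andP[_ /z0/ltW].
have K0 : 0 <= K by have := le_trans S0 SKL; rewrite pmulr_lge0.
have SE : S = SQ + SN.
  rewrite /S (bigID Q)/=; congr (_ + _); apply: eq_bigl => t; last exact: andbC.
  by apply/andb_idl/QA.
have SQS : SQ <= K * L by lra.
have zS t : t \in r -> Q t -> z t <= K * L.
  move=> tr Qt; apply: le_trans SQS; rewrite /SQ (big_rem t)//= Qt lerDl.
  by apply: sumr_ge0 => s /QA/z0/ltW.
(* If u_t >= 0 then z_t u_t <= L p_t. If u_t < 0, then z_t <= K L gives p_t exp(-u_t) <= K, and
   |u_t| <= exp(-u_t) gives p_t |u_t| <= K; the product yields K^2 / p_t. These are the two summands
   of [B]. *)
have zuB : \sum_(t <- r | Q t) z t * `|u t| <= B * L.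
  rewrite BE mulr_suml big_seq_cond [leRHS]big_seq_cond; apply: ler_sum => t /andP[tr Qt].
  have At := QA Qt; have pt := p0 At; have := zS _ tr Qt.
  rewrite /z qQ// [L * p t]mulrC => zt.
  have Ee : p t * expR (- u t) <= K.
    by rewrite -(ler_pM2r L0); apply: le_trans zt; rewrite mulrAC.
  have -> : p t * L * expR (- u t) * `|u t| = p t * expR (- u t) * `|u t| * L by ring.
  rewrite ler_wpM2r ?(ltW L0)//.
  have [ut|ut] := leP 0 (u t).
    have Kp : 0 <= K ^+ 2 / p t by rewrite mulr_ge0 ?sqr_ge0// invr_ge0 ltW.
    rewrite ger0_norm// -mulrA; apply: ler_wpDr => //.
    by rewrite ler_piMr ?expRN_mul_le1// ltW.
  apply: ler_wpDl; first exact: ltW.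
  rewrite ltr0_norm// ler_pdivlMr// expr2.
  have -> : p t * expR (- u t) * - u t * p t = (p t * expR (- u t)) * (p t * - u t) by ring.
  apply: ler_pM => //; rewrite ?mulr_ge0 ?(ltW pt) ?expR_ge0 ?oppr_ge0 ?(ltW ut)//.
  apply: le_trans Ee; rewrite ler_wpM2l ?(ltW pt)//.
  by have := expR_ge1Dx (- u t); lra.
(* The first term is the limiting dynamics; the others are the errors from replacing kappa by h,
   from the non-support part of S, and from the non-support positions themselves. *)
have splitE : \sum_(t <- r | A t) z t * S * kap t * u t =
  SQ * (\sum_(t <- r | Q t) z t * h t * u t) +
  SQ * (\sum_(t <- r | Q t) z t * (kap t - h t) * u t) +
  SN * (\sum_(t <- r | Q t) z t * kap t * u t) +
  S * (\sum_(t <- r | ~~ Q t && A t) z t * kap t * u t).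
  rewrite (bigID Q)/= !mulr_sumr -!big_split/=; congr (_ + _).
    apply: eq_big => t; first by apply/andb_idl/QA.
    by move=> _; rewrite SE; ring.
  by apply: eq_big => t; [exact: andbC|move=> _; ring].
have t1 : SQ * (\sum_(t <- r | Q t) z t * h t * u t) <=
  L ^+ 2 * ((\sum_(t <- r | Q t) h t * p t * u t) * \sum_(t <- r | Q t) p t).
  rewrite -subr_le0.
  suff -> : SQ * (\sum_(t <- r | Q t) z t * h t * u t) -
    L ^+ 2 * ((\sum_(t <- r | Q t) h t * p t * u t) * \sum_(t <- r | Q t) p t) =
    L ^+ 2 * \sum_(t <- r | Q t) h t * p t * u t * (\sum_(s <- r | Q s) p s * (expR (- (u t + u s)) - 1)).
    by rewrite mulr_ge0_le0// exprn_ge0// ltW.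
  rewrite [SQ * _]mulrC !mulr_suml !mulr_sumr -sumrB; apply: eq_bigr => t Qt.
  rewrite /SQ !mulr_sumr -sumrB; apply: eq_bigr => s Qs.
  rewrite /z !qQ// opprD expRD; ring.
have t2 : SQ * (\sum_(t <- r | Q t) z t * (kap t - h t) * u t) <= K * B * D * L ^+ 2.
  have -> : K * B * D * L ^+ 2 = (K * L) * (D * (B * L)) by ring.
  apply: le_trans (_ : SQ * (D * (B * L)) <= _); last first.
    rewrite ler_wpM2r// mulr_ge0//; apply: le_trans zuB.
    by apply: sumr_ge0 => t /QA/z0/ltW ?; rewrite mulr_ge0.
  rewrite ler_wpM2l//; apply: le_trans (ler_wpM2l D0 zuB).
  rewrite mulr_sumr; apply: ler_sum => t Qt.
  apply: le_trans (ler_norm _) _.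
  have -> : `|z t * (kap t - h t) * u t| = `|kap t - h t| * (z t * `|u t|).
    by rewrite (normrM _ (u t)) (normrM (z t)) (gtr0_norm (z0 (QA Qt))); ring.
  rewrite ler_wpM2r ?kD//.
  by rewrite mulr_ge0// ltW// z0// QA.
have t3 : SN * (\sum_(t <- r | Q t) z t * kap t * u t) <= K * B * C * g * L ^+ 2.
  have -> : K * B * C * g * L ^+ 2 = (g * (K * L)) * (C * (B * L)) by ring.
  have BL0 : 0 <= B * L.
    apply: le_trans zuB.
    by apply: sumr_ge0 => t /QA/z0/ltW ?; rewrite mulr_ge0.
  apply: le_trans (_ : SN * (C * (B * L)) <= _); last first.
    rewrite ler_wpM2r//; first by rewrite mulr_ge0// ltW.
    by apply: le_trans SNg _; rewrite ler_wpM2l.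
  rewrite ler_wpM2l//; apply: le_trans (ler_wpM2l (ltW C0) zuB).
  rewrite mulr_sumr; apply: ler_sum => t Qt.
  apply: le_trans (ler_norm _) _; have /andP[k1 k2] := kapP (QA Qt).
  have -> : `|z t * kap t * u t| = `|kap t| * (z t * `|u t|).
    by rewrite (normrM _ (u t)) (normrM (z t)) (gtr0_norm (z0 (QA Qt))); ring.
  rewrite ler_wpM2r//.
    by rewrite mulr_ge0// ltW// z0// QA.
  by rewrite ger0_norm//; lra.
(* Off the support only an upper bound is available: negative u_t help and are dropped, and positive
   ones give z_t u_t <= q_t. *)
have t4 : S * (\sum_(t <- r | ~~ Q t && A t) z t * kap t * u t) <=
  K * C * (L * \sum_(t <- r | ~~ Q t && A t) q t).
  have -> : K * C * (L * \sum_(t <- r | ~~ Q t && A t) q t) =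
    K * L * (C * \sum_(t <- r | ~~ Q t && A t) q t) by ring.
  apply: le_trans (_ : S * (C * \sum_(t <- r | ~~ Q t && A t) q t) <= _); last first.
    by rewrite ler_wpM2r// mulr_ge0 ?(ltW C0)// sumr_ge0// => t /andP[_ /q0/ltW].
  rewrite ler_wpM2l// mulr_sumr; apply: ler_sum => t /andP[_ At].
  have /andP[k1 k2] := kapP At; have qt := q0 At; have zt := z0 At.
  have [u0|u0] := leP (u t) 0.
    apply: (@le_trans _ _ 0); last by rewrite mulr_ge0 // ?ltW.
    by rewrite mulr_ge0_le0// ?mulr_ge0 ?(ltW zt)//; lra.
  have -> : z t * kap t * u t = kap t * (z t * u t) by ring.
  apply: ler_pM => //; rewrite ?mulr_ge0 ?(ltW zt)//; try lra.
  by rewrite /z -mulrA ler_piMr ?expRN_mul_le1// ltW.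
rewrite splitE; lra.
Qed.

(** [K] is the threshold of the far case, so the two cases are exhaustive. The deviation E S of
    kappa from h becomes E K L in the near case; in the far case the added errors are merely
    nonnegative. *)
Lemma drift_bound (K B g D E : R) :
  K = expR 1 * P + 2 * C * P / c ->
  B = \sum_(t <- r | Q t) (p t + K ^+ 2 / p t) -> 0 <= g ->
  SN <= g * SQ ->
  (forall t, Q t -> `|kap t - h t| <= D + E * S) -> 0 <= D -> 0 <= E ->
  \sum_(t <- r | Q t) h t * p t * u t * (\sum_(s <- r | Q s) p s * (expR (- (u t + u s)) - 1)) <= 0 ->
  \sum_(t <- r | A t) z t * S * kap t * u t
  <= L ^+ 2 * ((\sum_(t <- r | Q t) h t * p t * u t) * \sum_(t <- r | Q t) p t)
   + (K * B * (D + E * (K * L)) * L ^+ 2 + K * B * C * g * L ^+ 2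
   + K * C * (L * \sum_(t <- r | ~~ Q t && A t) q t)).
Proof.
move=> KE BE g0 SNg kD D0 E0 main.
have C0 : 0 < C := lt_le_trans c0 cC.
have P0 : 0 <= P by apply: sumr_ge0 => t /p0/ltW.
have K0 : 0 <= K.
  by rewrite KE addr_ge0 ?divr_ge0 ?mulr_ge0 ?expR_ge0 ?(ltW c0) ?(ltW C0).
have DE0 : 0 <= D + E * (K * L) by rewrite addr_ge0 ?mulr_ge0 ?(ltW L0).
have [SKL|KLS] := leP S (K * L).
  rewrite !addrA; apply: (drift_near BE g0 SKL SNg _ DE0 main) => t Qt.
  by apply: le_trans (kD _ Qt) _; rewrite lerD2l ler_wpM2l.
have B0 : 0 <= B.
  rewrite BE; apply: sumr_ge0 => t /QA/p0 pt.
  by rewrite addr_ge0 ?divr_ge0 ?sqr_ge0 ?(ltW pt).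
apply: le_trans (drift_far _) _.
  by rewrite -KE ler_pdivlMr// ltW.
rewrite lerDl !addr_ge0 ?mulr_ge0 ?sqr_ge0 ?(ltW L0) ?(ltW C0)//.
by apply: sumr_ge0 => t /andP[_ /q0/ltW].
Qed.

End Drift.

(** * Symmetrisation and the sign condition *)

Section Sign.
Variable R : realType.

Lemma sign_agree_expR (H U : R) : Num.sg H = Num.sg U ->
  H * (expR (- U) - 1) = - (`|H| * `|expR (- U) - 1|).
Proof.
have [U0|U0|->] := ltgtP U 0; last first.
- by rewrite oppr0 expR0 subrr normr0 !mulr0 oppr0.
- rewrite (gtr0_sg U0) => /eqP; rewrite sgr_cp0 => H0.
  rewrite (gtr0_norm H0) ltr0_norm ?mulrN ?opprK// subr_lt0.
  by rewrite expR_lt1 oppr_lt0.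
- rewrite (ltr0_sg U0) => /eqP; rewrite sgr_cp0 => H0.
  rewrite (ltr0_norm H0) gtr0_norm ?mulNr ?opprK// subr_gt0.
  by rewrite expR_gt1 oppr_gt0.
Qed.

Lemma symmetrized_drift_le0 (r : seq nat) (Q : pred nat) (p h u : nat -> R)
    (eps : R) (f := fun t s => p t * p s * `|h t * u t + h s * u s|
                         * `|expR (- (u t + u s)) - 1|) :
  (forall t, Q t -> 0 < p t) -> (forall t, Q t -> 0 < h t) -> eps < 2^-1 ->
  \sum_(t <- r | Q t) \sum_(s <- r | Q s && (s != t) &&
     (Num.sg (h t * u t + h s * u s) != Num.sg (u t + u s))) f t s
  <= eps * \sum_(t <- r | Q t) \sum_(s <- r | Q s && (s != t)) f t s ->
  \sum_(t <- r | Q t) h t * p t * u t *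
    (\sum_(s <- r | Q s) p s * (expR (- (u t + u s)) - 1)) <= 0.
Proof.
move=> p0 h0 eps2 bad.
pose v t s := p t * p s * (h t * u t + h s * u s) * (expR (- (u t + u s)) - 1).
pose ne t s := Num.sg (h t * u t + h s * u s) != Num.sg (u t + u s).
have sym : \sum_(t <- r | Q t) \sum_(s <- r | Q s) v t s =
  2 * \sum_(t <- r | Q t) h t * p t * u t *
    (\sum_(s <- r | Q s) p s * (expR (- (u t + u s)) - 1)).
  have vsplit t s : v t s = h t * p t * u t * (p s * (expR (- (u t + u s)) - 1)) +
       h s * p s * u s * (p t * (expR (- (u s + u t)) - 1)).
    by rewrite /v [u s + u t]addrC; ring.
  under eq_bigr do under eq_bigr do rewrite vsplit.
  under eq_bigr do rewrite big_split/=.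
  rewrite big_split/= [X in _ + X]exchange_big/= mulr2n mulrDl !mul1r.
  by congr (_ + _); apply: eq_bigr => t _; rewrite mulr_sumr.
have f0 t s : Q t -> Q s -> 0 <= f t s.
  by move=> /p0 ? /p0 ?; rewrite /f !mulr_ge0// ltW.
have vE t s : v t s = p t * p s * ((h t * u t + h s * u s) * (expR (- (u t + u s)) - 1)).
  by rewrite /v; ring.
have vagree t s : ~~ ne t s -> v t s = - f t s.
  rewrite negbK => /eqP sg_eq.
  by rewrite vE sign_agree_expR// /f; ring.
(* (A8) concerns only s <> t. On the diagonal H = 2 h_t u_t and U = 2 u_t, whose signs agree because
   h_t > 0. *)
have vdiag t : Q t -> v t t <= 0.
  move=> Qt; rewrite vagree ?oppr_le0 ?f0// negbK; apply/eqP.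
  have -> : h t * u t + h t * u t = h t * (u t + u t) by ring.
  by rewrite sgrM (gtr0_sg (h0 _ Qt)) mul1r.
have vle t s : Q t -> Q s -> v t s <= (if ne t s then 2 * f t s else 0) - f t s.
  move=> Qt Qs; case: ifPn => [_|/vagree ->]; last by rewrite sub0r.
  have -> : 2 * f t s - f t s = f t s by ring.
  rewrite vE /f -[X in _ <= X]mulrA ler_wpM2l ?mulr_ge0 ?(ltW (p0 _ _))//.
  by rewrite -normrM ler_norm.
have total0 : 0 <= \sum_(t <- r | Q t) \sum_(s <- r | Q s && (s != t)) f t s.
  by apply: sumr_ge0 => t Qt; apply: sumr_ge0 => s /andP[Qs _]; exact: f0.
suff : \sum_(t <- r | Q t) \sum_(s <- r | Q s) v t s <= 0 by rewrite sym pmulr_rle0.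
(* Agreeing pairs count as -f and disagreeing ones as at most +f, so the off-diagonal sum is at most
   2 bad - all <= (2 eps - 1) all. This is where eps < 1/2 enters. *)
apply: (@le_trans _ _ (2 * (\sum_(t <- r | Q t) \sum_(s <- r | Q s && (s != t) && ne t s) f t s)
  - \sum_(t <- r | Q t) \sum_(s <- r | Q s && (s != t)) f t s)); last first.
  set X := \sum_(t <- r | Q t) _ in bad *.
  set Y := \sum_(t <- r | Q t) _ in bad total0 *.
  have : eps * Y <= 2^-1 * Y by rewrite ler_wpM2r// ltW.
  by move: bad; rewrite -/X; lra.
rewrite mulr_sumr -sumrB; apply: ler_sum => t Qt.
rewrite (bigID (fun s => s != t))/= -[leRHS]addr0 lerD//; last first.
  by apply: sumr_le0 => s /andP[Qs]; rewrite negbK => /eqP ->; exact: vdiag.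
rewrite mulr_sumr [X in _ <= X - _]big_mkcondr -sumrB/=; apply: ler_sum => s /andP[Qs _].
exact: vle.
Qed.

End Sign.

(** * Gradient of the loss *)

Section Dot.
Variables (R : realType) (m : nat).
Implicit Types u v w : 'rV[R]_m.

Lemma dotvC u v : dotv u v = dotv v u.
Proof. by apply: eq_bigr => k _; rewrite mulrC. Qed.

Lemma dotvDl u v w : dotv (u + v) w = dotv u w + dotv v w.
Proof. by rewrite /dotv -big_split; apply: eq_bigr => k _; rewrite mxE mulrDl. Qed.

Lemma dotvZl c u w : dotv (c *: u) w = c * dotv u w.
Proof. by rewrite /dotv mulr_sumr; apply: eq_bigr => k _; rewrite mxE mulrA. Qed.

Lemma dotvNl u w : dotv (- u) w = - dotv u w.
Proof. by rewrite -scaleN1r dotvZl mulN1r. Qed.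

Lemma dotvBl u v w : dotv (u - v) w = dotv u w - dotv v w.
Proof. by rewrite dotvDl dotvNl. Qed.

Lemma dotvDr u v w : dotv w (u + v) = dotv w u + dotv w v.
Proof. by rewrite !(dotvC w) dotvDl. Qed.

Lemma dotvZr c u w : dotv w (c *: u) = c * dotv w u.
Proof. by rewrite !(dotvC w) dotvZl. Qed.

Lemma dotvBr u v w : dotv w (u - v) = dotv w u - dotv w v.
Proof. by rewrite !(dotvC w) dotvBl. Qed.

Lemma dot0v w : dotv 0 w = 0.
Proof. by rewrite -(scale0r w) dotvZl mul0r. Qed.

Lemma dotv_suml (I : Type) (r : seq I) (P : pred I) (F : I -> 'rV[R]_m) w :
  dotv (\sum_(i <- r | P i) F i) w = \sum_(i <- r | P i) dotv (F i) w.
Proof. by elim/big_rec2: _ => [|i x y _ <-]; rewrite ?dot0v// dotvDl. Qed.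

Lemma dotv_sumr (I : Type) (r : seq I) (P : pred I) (F : I -> 'rV[R]_m) w :
  dotv w (\sum_(i <- r | P i) F i) = \sum_(i <- r | P i) dotv w (F i).
Proof. by rewrite dotvC dotv_suml; apply: eq_bigr => i _; rewrite dotvC. Qed.

Lemma dotv_delta k v : dotv (delta_mx 0 k) v = v 0 k.
Proof.
rewrite /dotv (bigD1 k)//= mxE !eqxx mul1r big1 ?addr0// => j jk.
by rewrite mxE (negbTE jk) andbF mul0r.
Qed.

Lemma dotvv_ge0 u : 0 <= dotv u u.
Proof. by apply: sumr_ge0 => k _; rewrite -expr2 sqr_ge0. Qed.

Lemma normv_sqr u : normv u ^+ 2 = dotv u u.
Proof. by rewrite sqr_sqrtr// dotvv_ge0. Qed.

Lemma dotvvD u v : dotv (u + v) (u + v) = dotv u u + 2 * dotv v u + dotv v v.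
Proof. by rewrite !dotvDl !dotvDr (dotvC u v); ring. Qed.

Lemma dotv_young u v : `|2 * dotv u v| <= dotv u u + dotv v v.
Proof.
have := dotvv_ge0 (u + v); have := dotvv_ge0 (- u + v).
rewrite !dotvvD !dotvNl (dotvC u (- u)) dotvNl (dotvC v (- u)) dotvNl (dotvC v u).
by move=> ? ?; rewrite ler_norml; apply/andP; split; lra.
Qed.

End Dot.

Lemma normv_gt0 (R : realType) (m : nat) (u v : 'rV[R]_m) :
  dotv u v != 0 -> 0 < normv u.
Proof.
rewrite sqrtr_gt0 lt0r dotvv_ge0 andbT; apply: contra => /eqP uu0.
apply/eqP/big1 => k _; have /eqP := @psumr_eq0P _ _ _ _ (fun k _ => sqr_ge0 (u 0 k)) uu0 k isT.
by rewrite mulf_eq0 orbb => /eqP ->; rewrite mul0r.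
Qed.

Lemma is_derive_bigsum (R : realType) (I : Type) (r : seq I) (P : pred I)
    (F : I -> R -> R) (dF : I -> R) (x : R) :
  (forall i, P i -> is_derive x 1 (F i) (dF i)) ->
  is_derive x 1 (fun s => \sum_(i <- r | P i) F i s) (\sum_(i <- r | P i) dF i).
Proof.
move=> FP; elim: r => [|i r IH].
  rewrite big_nil; under eq_fun do rewrite big_nil; exact: is_derive_cst.
rewrite big_cons; under eq_fun do rewrite big_cons.
by case: ifPn => // Pi; apply: is_deriveD (FP _ Pi) IH.
Qed.

Lemma is_derive_line (R : realType) (m : nat) (f : 'rV[R]_m -> R) (x v : 'rV[R]_m) (l : R) :
  is_derive (0 : R) 1 (fun s => f (x + s *: v)) l -> is_derive x v f l.
Proof.
have E : (fun h : R => h^-1 *: (((fun s => f (x + s *: v)) \o shift 0) (h *: 1) -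
            (fun s => f (x + s *: v)) 0)) =
         (fun h : R => h^-1 *: ((f \o shift x) (h *: v) - f x)).
  apply/funext => h /=; rewrite addr0 scale0r addr0.
  by rewrite [h *: 1]mulr1 [x + _]addrC.
by move=> [dl vl]; split; [rewrite /derivable -E|rewrite /derive -E].
Qed.

Section Gradient.
Variable R : realType.
Variables (n d T : nat) (e : 'I_n -> nat -> 'rV[R]_d) (y : 'I_n -> nat).
Hypothesis yT : forall i, (1 <= y i < T)%N.
Implicit Types (w v : 'rV[R]_(d * d)) (i : 'I_n) (t : nat).

(** Softmax numerators divided by that of the match: the match gets value 1 and the denominator
    becomes 1 + S. *)
Definition expmargin w i t : R := expR (- dotv w (xtil e y i t)).
Definition expmargin_sum w i : R := \sum_(1 <= t < T | t != y i) expmargin w i t.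
Definition match_weight w i : R := (1 + expmargin_sum w i)^-1.

Lemma expmargin_gt0 w i t : 0 < expmargin w i t. Proof. exact: expR_gt0. Qed.

Lemma expmargin_sum_ge0 w i : 0 <= expmargin_sum w i.
Proof. by apply: sumr_ge0 => t _; exact/ltW/expmargin_gt0. Qed.

Lemma match_weight_gt0 w i : 0 < match_weight w i.
Proof. by rewrite invr_gt0 ltr_pwDl// expmargin_sum_ge0. Qed.

Lemma expmargin_match w i : expmargin w i (y i) = 1.
Proof. by rewrite /expmargin /xtil subrr dotvC dot0v oppr0 expR0. Qed.

Lemma sum_expmargin w i : \sum_(1 <= t < T) expmargin w i t = 1 + expmargin_sum w i.
Proof.
rewrite (bigD1_seq (y i)) ?iota_uniq ?mem_index_iota//=.
by rewrite expmargin_match.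
Qed.

Lemma attnE w i t : attn T e y w i t = expmargin w i t * match_weight w i.
Proof.
have E s : expR (dotv w (xt e y i s)) = expR (dotv w (xt e y i (y i))) * expmargin w i s.
  by rewrite /expmargin -expRD /xtil dotvBr; congr expR; ring.
rewrite /attn E; under eq_bigr do rewrite E.
rewrite -mulr_sumr sum_expmargin /match_weight; field.
have := expmargin_sum_ge0 w i; have := expR_gt0 (dotv w (xt e y i (y i))).
by move=> a b; rewrite (gt_eqF a) andbT gt_eqF//; lra.
Qed.

Lemma attn_sum1 w i : \sum_(1 <= t < T) attn T e y w i t = 1.
Proof.
under eq_bigr do rewrite attnE.
by rewrite -mulr_suml sum_expmargin mulfV// gt_eqF// ltr_pwDl// expmargin_sum_ge0.
Qed.

Lemma residualE w i : attn_out T e y w i - e i (y i).+1 =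
  \sum_(1 <= t < T) attn T e y w i t *: dd e y i t.
Proof.
rewrite /attn_out /dd; under [RHS]eq_bigr do rewrite scalerBr.
rewrite sumrB -scaler_suml attn_sum1 scale1r; congr (_ - _).
have T1 : (0 < T)%N by case/andP: (yT i) => /leq_trans H /ltnW; exact: H.
rewrite big_nat_recl// {1}/aw/= scale0r add0r; apply: eq_big_nat => t /andP[t1 _].
by rewrite /aw ltnS leqNgt t1.
Qed.

Lemma residual_coord w i k : (attn_out T e y w i - e i (y i).+1) 0 k =
  (\sum_(1 <= t < T) expmargin w i t * dd e y i t 0 k) * (\sum_(1 <= t < T) expmargin w i t)^-1.
Proof.
rewrite residualE summxE mulr_suml; apply: eq_bigr => t _.
by rewrite mxE attnE sum_expmargin mulrAC.
Qed.

Lemma MSE_derive w v : is_derive w v (MSE T e y)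
  (\sum_(i < n) \sum_(1 <= t < T | t != y i)
     dotv v (xtil e y i t) * attn T e y w i t *
     (normv (attn_out T e y w i - e i (y i).+1) ^+ 2
      - dotv (dd e y i t) (attn_out T e y w i - e i (y i).+1))).
Proof.
apply: is_derive_line.
pose c i t := dotv v (xtil e y i t).
pose z i t (s : R) := expmargin (w + s *: v) i t.
pose N i k s := \sum_(1 <= t < T) z i t s * dd e y i t 0 k.
pose Z i s := \sum_(1 <= t < T) z i t s.
pose o i k s := N i k s * (Z i s)^-1.
have Z0 i s : Z i s != 0.
  by rewrite /Z /z sum_expmargin gt_eqF// ltr_pwDl// expmargin_sum_ge0.
have dz i t : is_derive (0 : R) 1 (z i t) (- c i t * z i t 0).
  have -> : z i t = expR \o (fun s => - dotv w (xtil e y i t) + s * - c i t).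
    by apply/funext => s; rewrite /z /expmargin /= dotvDl dotvZl /c mulrN opprD.
  have H : is_derive (0 : R) 1 (fun s => - dotv w (xtil e y i t) + s * - c i t) (- c i t).
    have -> : (fun s => - dotv w (xtil e y i t) + s * - c i t) =
       cst (- dotv w (xtil e y i t)) + (- c i t) \*: (@id R).
      by apply/funext => s; rewrite fctE /= mulrC.
    apply: is_derive_eq.
    by rewrite add0r [LHS]mulr1.
  apply: (is_derive_eq (is_derive1_comp (is_derive_expR _) H)).
  exact: mulrC.
have dN i k : is_derive (0 : R) 1 (N i k) (\sum_(1 <= t < T) - c i t * z i t 0 * dd e y i t 0 k).
  apply: is_derive_bigsum => t _.
  have -> : (fun s => z i t s * dd e y i t 0 k) = (dd e y i t 0 k) \*: z i t.
    by apply/funext => s /=; rewrite mulrC.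
  by apply: is_derive_eq; rewrite [LHS]mulrC.
have dZ i : is_derive (0 : R) 1 (Z i) (\sum_(1 <= t < T) - c i t * z i t 0).
  exact: is_derive_bigsum.
(* Quotient rule for N/Z: since z_t' = - c_t z_t, the derivative is an attention-weighted sum of c_t
   (o - dd_t). *)
have dO i k : is_derive (0 : R) 1 (o i k)
    (\sum_(1 <= t < T) c i t * (z i t 0 / Z i 0) * (o i k 0 - dd e y i t 0 k)).
  apply: (is_derive_eq (f := N i k * (fun s => (Z i s)^-1))
    (is_deriveM (dN i k) (is_deriveV (Z0 i 0) (dZ i)))).
  rewrite /GRing.scale/=.
  transitivity (\sum_(1 <= t < T) (- (c i t * (z i t 0 / Z i 0) * dd e y i t 0 k) +
                  c i t * (z i t 0 / Z i 0) * o i k 0)).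
    rewrite big_split/= addrC; congr (_ + _).
      rewrite !mulr_sumr; apply: eq_bigr => t _; rewrite /o.
      by field; exact: Z0.
    by rewrite mulr_sumr; apply: eq_bigr => t _; ring.
  by apply: eq_bigr => t _; ring.
have -> : (fun s => MSE T e y (w + s *: v)) =
  (fun s => \sum_(i < n) \sum_(k < d) 2^-1 * (o i k s * o i k s)).
  apply/funext => s; apply: eq_bigr => i _.
  rewrite normv_sqr /dotv mulr_sumr; apply: eq_bigr => k _.
  by rewrite !residual_coord.
apply: (@is_derive_eq _ _ _ _ _ _ _ (\sum_(i < n) \sum_(k < d) 2^-1 *
   (2 * (o i k 0 * (\sum_(1 <= t < T) c i t * (z i t 0 / Z i 0) * (o i k 0 - dd e y i t 0 k)))))).
  apply: is_derive_bigsum => i _; apply: is_derive_bigsum => k _.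
  have -> : (fun s => 2^-1 * (o i k s * o i k s)) = 2^-1 \*: (o i k * o i k) by [].
  apply: is_derive_eq; congr (_ * _).
  by rewrite /GRing.scale/= mulr2n mulrDl mul1r.
have w0 : w + 0 *: v = w by rewrite scale0r addr0.
have zattn i t : z i t 0 / Z i 0 = attn T e y w i t.
  by rewrite /z /Z /z w0 sum_expmargin attnE.
have oE i k : o i k 0 = (attn_out T e y w i - e i (y i).+1) 0 k.
  by rewrite residual_coord /o /N /Z /z w0.
apply: eq_bigr => i _.
under eq_bigr do rewrite mulKf ?pnatr_eq0// mulr_sumr.
rewrite exchange_big/= [LHS](bigD1_seq (y i)) ?iota_uniq ?mem_index_iota//=.
rewrite big1 ?add0r; last first.
  by move=> k _; rewrite /c /xtil subrr dotvC dot0v mul0r mul0r mulr0.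
apply: eq_bigr => t _; rewrite normv_sqr -/(c i t) /dotv -sumrB mulr_sumr.
by apply: eq_bigr => k _; rewrite zattn !oE; ring.
Qed.

End Gradient.

Lemma exists_nonmatch (T k : nat) : (3 <= T)%N ->
  exists2 t, (1 <= t < T)%N & t != k.
Proof.
move=> T3; have [->|k1] := eqVneq k 1%N; first by exists 2%N.
by exists 1%N; rewrite ?(leq_trans _ T3)// eq_sym.
Qed.

(** * Gradient coefficients and the size of S *)

Section Kappa.
Variable R : realType.
Variables (n d T : nat) (e : 'I_n -> nat -> 'rV[R]_d) (y : 'I_n -> nat).
Hypothesis T3 : (3 <= T)%N.
Hypothesis yT : forall i, (1 <= y i < T)%N.
Implicit Types (w v : 'rV[R]_(d * d)) (i : 'I_n) (t : nat).

Local Notation z := (expmargin e y).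
Local Notation S := (expmargin_sum T e y).
Local Notation b := (match_weight T e y).
Local Notation o w i := (attn_out T e y w i - e i (y i).+1).

Lemma expmargin_sum_gt0 w i : 0 < S w i.
Proof.
have [t t1 t2] := exists_nonmatch (y i) T3.
rewrite /expmargin_sum big_mkcond (bigD1_seq t) ?iota_uniq ?mem_index_iota//= t2.
rewrite ltr_pwDl ?expmargin_gt0// sumr_ge0// => s _; case: ifP => // _.
exact/ltW/expmargin_gt0.
Qed.

Lemma dd_y i : dd e y i (y i) = 0.
Proof. exact: subrr. Qed.

(** Since 1 - b = b S, the factor b cancels and h_t is a z-weighted average of the inner products in
    (A4); its bounds come from there. *)
Lemma hhE w i t :
  hh T e y w i t = (\sum_(1 <= s < T | s != y i) dotv (dd e y i t) (dd e y i s) * z w i s) / S w i.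
Proof.
rewrite /hh mulr_suml; apply: eq_bigr => s _.
rewrite !(attnE _ yT) expmargin_match mul1r -[RHS]mulrA; congr (_ * _).
have := expmargin_sum_gt0 w i; rewrite /match_weight => S0; field.
by apply/andP; split; apply/negP => /eqP; lra.
Qed.

Lemma dotv_dd_residual w i t : dotv (dd e y i t) (o w i) = b w i * S w i * hh T e y w i t.
Proof.
rewrite (residualE _ yT) dotv_sumr (bigD1_seq (y i)) ?iota_uniq ?mem_index_iota//=.
rewrite dd_y scaler0 dotvC dot0v add0r hhE.
rewrite -[RHS]mulrA [S w i * _]mulrC divfK ?gt_eqF ?expmargin_sum_gt0// [RHS]mulrC.
by rewrite mulr_suml; apply: eq_bigr => s _; rewrite dotvZr (attnE _ yT); ring.
Qed.

Lemma residual_sqr w i : normv (o w i) ^+ 2 =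
  b w i ^+ 2 * S w i * \sum_(1 <= t < T | t != y i) z w i t * hh T e y w i t.
Proof.
rewrite normv_sqr {1}(residualE _ yT) dotv_suml.
rewrite (bigD1_seq (y i)) ?iota_uniq ?mem_index_iota//=.
rewrite dd_y scaler0 dot0v add0r mulr_sumr; apply: eq_bigr => t _.
by rewrite dotvZl dotv_dd_residual (attnE _ yT); ring.
Qed.

(** The kappa_t of the overview: <dd_t, o> = b S h_t and |o|^2 = b^2 S sum_s z_s h_s, so z_t S
    factors out of the derivative of the loss. *)
Definition grad_coef w i t : R :=
  b w i ^+ 2 * (hh T e y w i t - b w i * \sum_(1 <= s < T | s != y i) z w i s * hh T e y w i s).

Lemma MSE_gradient w g : is_gradient (MSE T e y) w g ->
  g = - \sum_(i < n) \sum_(1 <= t < T | t != y i) (z w i t * S w i * grad_coef w i t) *: xtil e y i t.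
Proof.
move=> grad; apply/rowP => k.
have [_ <-] := grad k; have [_ ->] := MSE_derive e yT w (delta_mx 0 k).
rewrite mxE summxE -sumrN; apply: eq_bigr => i _.
rewrite summxE -sumrN; apply: eq_bigr => t _.
rewrite mxE dotv_delta dotv_dd_residual residual_sqr (attnE _ yT) /grad_coef; ring.
Qed.

Section Bounds.
Variables (i : 'I_n) (c C : R).
Hypothesis c0 : 0 < c.
Hypothesis ddP : forall t s, (1 <= t < T)%N -> t != y i -> (1 <= s < T)%N -> s != y i ->
  c <= dotv (dd e y i t) (dd e y i s) <= C.

Lemma hh_bounds w t : (1 <= t < T)%N -> t != y i -> c <= hh T e y w i t <= C.
Proof.
move=> tT ty; rewrite hhE ler_pdivlMr ?expmargin_sum_gt0// ler_pdivrMr ?expmargin_sum_gt0//.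
rewrite /expmargin_sum !mulr_sumr; apply/andP; split; rewrite big_nat_cond [leRHS]big_nat_cond;
  apply: ler_sum => s /andP[sT sy]; have /andP[? ?] := ddP tT ty sT sy;
  by rewrite ler_wpM2r// ltW// expmargin_gt0.
Qed.

Let H w := \sum_(1 <= s < T | s != y i) z w i s * hh T e y w i s.

Let HP w : c * S w i <= H w <= C * S w i.
Proof.
rewrite /H /expmargin_sum !mulr_sumr; apply/andP; split; rewrite big_nat_cond [leRHS]big_nat_cond;
  apply: ler_sum => s /andP[sT sy]; have /andP[? ?] := hh_bounds w sT sy;
  by rewrite [_ * z w i s]mulrC ler_wpM2l// ltW// expmargin_gt0.
Qed.

Let bP w : [/\ 0 < b w i, b w i <= 1 & b w i * S w i = 1 - b w i].
Proof.
have S0 := expmargin_sum_gt0 w i; split; first exact: match_weight_gt0.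
  by rewrite /match_weight invf_le1; lra.
by rewrite /match_weight; field; apply/negP => /eqP; lra.
Qed.

(** S <= 1 gives b^2 >= 1/4, and C S <= c/2 leaves h_t - b sum_s z_s h_s >= c/2; hence c/8. *)
Lemma grad_coef_bounds w t : (1 <= t < T)%N -> t != y i -> S w i <= 1 -> C * S w i <= c / 2 ->
  c / 8 <= grad_coef w i t <= C.
Proof.
move=> tT ty S1 CS; have [b0 b1 bS] := bP w; have /andP[h1 h2] := hh_bounds w tT ty.
have /andP[H1 H2] := HP w; have S0 := expmargin_sum_gt0 w i.
rewrite /grad_coef -/(H w); set bw := b w i in b0 b1 bS *.
have b2 : 2^-1 <= bw.
  have : bw * S w i <= bw * 1 by rewrite ler_wpM2l// ltW.
  lra.
have bb1 : bw ^+ 2 <= 1 by rewrite expr_le1// ltW.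
have bb2 : 4^-1 <= bw ^+ 2.
  have -> : 4^-1 = 2^-1 * 2^-1 :> R by field.
  by rewrite expr2 ler_pM.
have cS0 : 0 <= c * S w i by rewrite mulr_ge0 ?(ltW c0)// ltW.
have bH0 : 0 <= bw * H w by rewrite mulr_ge0 ?(ltW b0)//; lra.
have bH1 : bw * H w <= c / 2.
  have : bw * H w <= 1 * H w by rewrite ler_wpM2r//; lra.
  lra.
have c_gt0 := c0.
apply/andP; split.
  apply: (@le_trans _ _ (4^-1 * (c / 2))); first by lra.
  by apply: ler_pM => //; lra.
apply: (@le_trans _ _ (1 * (hh T e y w i t - bw * H w))); last by lra.
by rewrite ler_wpM2r//; lra.
Qed.

Lemma grad_coef_hh w t : (1 <= t < T)%N -> t != y i ->
  `|grad_coef w i t - hh T e y w i t| <= 3 * C * S w i.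
Proof.
move=> tT ty; have [b0 b1 bS] := bP w; have /andP[h1 h2] := hh_bounds w tT ty.
have /andP[H1 H2] := HP w; have S0 := expmargin_sum_gt0 w i; have c_gt0 := c0.
rewrite /grad_coef -/(H w); set bw := b w i in b0 b1 bS *; set h := hh T e y w i t in h1 h2 *.
have bSS : bw * S w i <= 1 * S w i by rewrite ler_wpM2r// ltW.
have cS0 : 0 <= c * S w i by rewrite mulr_ge0 ?(ltW c0)// ltW.
have -> : bw ^+ 2 * (h - bw * H w) - h = - (h * ((1 - bw) * (1 + bw)) + bw ^+ 3 * H w) by ring.
have a0 : 0 <= h * ((1 - bw) * (1 + bw)) by rewrite !mulr_ge0//; lra.
have a1 : h * ((1 - bw) * (1 + bw)) <= C * (S w i * 2).
  by apply: ler_pM => //; rewrite ?mulr_ge0//; try lra; apply: ler_pM; lra.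
have a2 : 0 <= bw ^+ 3 * H w by rewrite mulr_ge0 ?exprn_ge0 ?(ltW b0)//; lra.
have a3 : bw ^+ 3 * H w <= 1 * H w.
  by rewrite ler_wpM2r ?expr_le1 ?(ltW b0)//; lra.
rewrite normrN ger0_norm; last exact: addr_ge0.
have -> : 3 * C * S w i = C * (S w i * 2) + C * S w i by ring.
lra.
Qed.

Lemma MSE_lower w : c / 2 * (b w i * S w i) ^+ 2 <= MSE T e y w.
Proof.
apply: (@le_trans _ _ (2^-1 * normv (o w i) ^+ 2)); last first.
  rewrite /MSE (bigD1 i)//= lerDl sumr_ge0// => j _.
  by rewrite mulr_ge0 ?sqr_ge0// invr_ge0.
rewrite residual_sqr -/(H w); have /andP[H1 _] := HP w.
have -> : c / 2 * (b w i * S w i) ^+ 2 = 2^-1 * (b w i ^+ 2 * S w i * (c * S w i)) by ring.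
apply: ler_wpM2l; first by rewrite invr_ge0.
by apply: ler_wpM2l H1; rewrite mulr_ge0 ?sqr_ge0 ?expmargin_sum_ge0.
Qed.

Lemma expmargin_sum_small (w : nat -> 'rV[R]_(d * d)) (sg : R) : 0 < sg ->
  (fun tau => MSE T e y (w tau)) @ \oo --> 0 ->
  \forall tau \near \oo, S (w tau) i <= sg.
Proof.
move=> sg0 /cvgrPdist_lt MSE0; have c_gt0 := c0.
(* b S = S/(1 + S) is increasing in S, so the level [sg] for S corresponds to this level of the
   lower bound on the loss. *)
have E0 : 0 < c / 2 * (sg / (1 + sg)) ^+ 2.
  by rewrite mulr_gt0 ?exprn_gt0 ?divr_gt0//; lra.
near=> tau.
have : `|0 - MSE T e y (w tau)| < c / 2 * (sg / (1 + sg)) ^+ 2.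
  by near: tau; exact: MSE0.
have M := MSE_lower (w tau).
rewrite sub0r normrN => /(le_lt_trans (ler_norm _)) /(le_lt_trans M).
have [b0 _ bS] := bP (w tau); have S0 := expmargin_sum_gt0 (w tau) i.
have c2 : 0 < c / 2 by lra.
have bS0 : 0 <= b (w tau) i * S (w tau) i by rewrite mulr_ge0// ltW.
have sg1 : 0 <= sg / (1 + sg) by rewrite divr_ge0//; lra.
rewrite (ltr_pM2l c2) ltr_sqr ?nnegrE//.
rewrite ltr_pdivlMr; last by lra.
rewrite mulrDr mulr1 bS [(1 - _) * _]mulrBl mul1r => bSsg.
by rewrite ltW// -(ltr_pM2l b0) bS; lra.
Unshelve. all: by end_near. Qed.

End Bounds.
End Kappa.

(** * Convergence *)

Section SampleDrift.
Variable R : realType.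
Variables (n d T : nat) (e : 'I_n -> nat -> 'rV[R]_d) (y : 'I_n -> nat).
Hypothesis T3 : (3 <= T)%N.
Hypothesis yT : forall i, (1 <= y i < T)%N.
Variables (w : nat -> 'rV[R]_(d * d)) (wh wt : 'rV[R]_(d * d)) (hinf : 'I_n -> nat -> R).

Local Notation u tau := (uu e y w wh wt tau).
Local Notation p := (pp e y wt).
Local Notation SV := (isSV T e y wh).

Lemma expmargin_rescaled tau i t : expmargin e y (w tau) i t =
  expR (- (2^-1 * ln tau%:R * dotv wh (xtil e y i t))) * p i t * expR (- u tau i t).
Proof.
rewrite /expmargin /pp /uu /rr -!expRD !dotvBl dotvZl; congr expR; ring.
Qed.

Lemma sample_drift (i : 'I_n) (c C eps : R) (g : nat -> R) : 0 < c ->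
  (forall t s, (1 <= t < T)%N -> t != y i -> (1 <= s < T)%N -> s != y i ->
     c <= dotv (dd e y i t) (dd e y i s) <= C) ->
  margin_feasible T e y wh ->
  (fun tau => MSE T e y (w tau)) @ \oo --> 0 ->
  (forall t, (1 <= t < T)%N -> t != y i ->
     (fun tau => hh T e y (w tau) i t) @ \oo --> hinf i t /\
     cvg (series (fun tau : nat =>
              (tau%:R)^-1 * `|hh T e y (w tau) i t - hinf i t|) @ \oo)) ->
  eps < 2^-1 ->
  (forall tau, 0 <= g tau) ->
  nneg_summable (fun tau : nat => g tau * (tau%:R)^-1) ->
  (forall tau,
     \sum_(1 <= s < T | ~~ SV i s && (s != y i)) expmargin e y (w tau) i s
     <= g tau * \sum_(1 <= s < T | SV i s) expmargin e y (w tau) i s) ->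
  (\forall tau \near \oo,
     \sum_(1 <= t < T | SV i t)
       \sum_(1 <= s < T | SV i s && (s != t) &&
               (Num.sg (HH e y hinf w wh wt tau i t s)
                  != Num.sg (UU e y w wh wt tau i t s)))
         A8term e y hinf w wh wt tau i t s
     <= eps *
     \sum_(1 <= t < T | SV i t)
       \sum_(1 <= s < T | SV i s && (s != t))
         A8term e y hinf w wh wt tau i t s) ->
  exists2 beta, nneg_summable beta & \forall tau \near \oo,
    \sum_(1 <= t < T | t != y i)
      expmargin e y (w tau) i t * expmargin_sum T e y (w tau) i * grad_coef T e y (w tau) i t * u tau i t
    <= tau%:R^-1 * ((\sum_(1 <= t < T | SV i t) hinf i t * p i t * u tau i t) *
                   \sum_(1 <= t < T | SV i t) p i t) + beta tau.
Proof.
move=> c0 ddP feas MSE0 A7 eps2 g0 gsum A9 A8.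
have cC : c <= C.
  have [t t1 t2] := exists_nonmatch (y i) T3.
  by have /andP[+ +] := ddP t t t1 t2 t1 t2; exact: le_trans.
have C0 := lt_le_trans c0 cC.
pose r := index_iota 1 T.
pose A t := (1 <= t < T)%N && (t != y i).
pose Q t := SV i t.
have QA t : Q t -> A t by case/and3P => tT ty _; rewrite /A tT.
have p0 t : 0 < p i t by exact: expR_gt0.
have hinfP t : Q t -> c <= hinf i t <= C.
  move=> /QA/andP[tT ty]; have [hcv _] := A7 _ tT ty.
  have hcv' := cvgP _ hcv; have <- := cvg_lim (@Rhausdorff R) hcv.
  by apply/andP; split; [apply: limr_ge|apply: limr_le] => //;
    apply: nearW => tau; have /andP[] := hh_bounds T3 yT ddP (w tau) tT ty.
pose m t := dotv wh (xtil e y i t).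
pose K := expR 1 * (\sum_(t <- r | A t) p i t) + 2 * C * (\sum_(t <- r | A t) p i t) / (c / 8).
pose B := \sum_(t <- r | Q t) (p i t + K ^+ 2 / p i t).
have K0 : 0 <= K.
  have P0 : 0 <= \sum_(t <- r | A t) p i t by apply: sumr_ge0 => t _; exact: ltW.
  by rewrite addr_ge0 ?divr_ge0 ?mulr_ge0 ?expR_ge0 ?(ltW c0) ?(ltW C0).
have B0 : 0 <= B.
  apply: sumr_ge0 => t _.
  by apply: addr_ge0; [exact: ltW|apply: mulr_ge0; rewrite ?sqr_ge0 ?invr_ge0 ?ltW].
(* The four errors of [drift_bound] with L = tau^(-1/2): (A7) against L^2, the kappa deviation
   against L^3, (A9) against L^2, and L q_t = p_t tau^(-(1 + m_t)/2) off the support, where the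
   margin m_t exceeds 1. *)
pose beta (tau : nat) : R :=
  K * B * (\sum_(t <- r | Q t) tau%:R^-1 * `|hh T e y (w tau) i t - hinf i t|)
  + K * B * (3 * C * K) * expR (- (3 / 2 * ln tau%:R))
  + K * B * C * (g tau * tau%:R^-1)
  + K * C * (\sum_(t <- r | ~~ Q t && A t) p i t * expR (- ((1 + m t) / 2 * ln tau%:R))).
exists beta.
  apply: nneg_summableD.
    apply: nneg_summableD.
      apply: nneg_summableD.
        apply: nneg_summableZ; first exact: mulr_ge0.
        apply: nneg_summable_sum => t /QA/andP[tT ty].
        apply: nneg_summable_series => [k|]; last by have [] := A7 _ tT ty.
        by rewrite mulr_ge0// invr_ge0.
      apply: nneg_summableZ; first by rewrite !mulr_ge0// ltW.
      by apply: nneg_summable_ln; lra.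
    by apply: nneg_summableZ => //; rewrite !mulr_ge0// ltW.
  apply: nneg_summableZ; first by rewrite !mulr_ge0// ltW.
  apply: nneg_summable_sum => t /andP[nQ /andP[tT ty]].
  apply: nneg_summableZ; first exact: ltW.
  apply: nneg_summable_ln.
  have m1 : 1 <= m t by exact: feas.
  have mn1 : m t != 1 by apply: contra nQ => m1'; rewrite /Q /isSV tT ty.
  have : 1 < m t by rewrite lt_neqAle eq_sym mn1.
  lra.
have S1 : \forall tau \near \oo, expmargin_sum T e y (w tau) i <= 1.
  exact: (expmargin_sum_small T3 yT c0 ddP ltr01 MSE0).
have cC2 : 0 < c / 2 / C by rewrite !divr_gt0.
have S2 : \forall tau \near \oo, expmargin_sum T e y (w tau) i <= c / 2 / C.
  exact: (expmargin_sum_small T3 yT c0 ddP cC2 MSE0).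
near=> tau.
have tau1 : (1 <= tau)%N by near: tau; exact: nbhs_infty_ge.
have tau0 : 0 < tau%:R :> R by rewrite ltr0n.
have ln0 : 0 <= ln tau%:R :> R by apply: ln_ge0; rewrite ler1n.
pose L : R := expR (- (2^-1 * ln tau%:R)).
have L0 : 0 < L by exact: expR_gt0.
have L2 : L ^+ 2 = tau%:R^-1.
  rewrite -expRM_natl -[in RHS](lnK tau0) -expRN; congr expR.
  by rewrite -mulrN mulrA mulfV ?mul1r// pnatr_eq0.
(* That is, tau^(-m_t/2) p_t: feasibility m_t >= 1 gives q_t <= L p_t, with equality exactly where
   m_t = 1, on the support vectors. *)
pose q t := expR (- (2^-1 * ln tau%:R * m t)) * p i t.
have q0 t : 0 < q t by rewrite mulr_gt0 ?expR_gt0.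
have qL t : A t -> q t <= L * p i t.
  move=> /andP[tT ty]; rewrite ler_wpM2r ?(ltW (p0 _))// ler_expR lerN2.
  by rewrite ler_peMr ?mulr_ge0 ?invr_ge0//; exact: feas.
have qQ t : Q t -> q t = L * p i t.
  by rewrite /q /L /m => /and3P[_ _ /eqP ->]; rewrite mulr1.
have zE t : expmargin e y (w tau) i t = q t * expR (- u tau i t) by rewrite expmargin_rescaled.
have SE : expmargin_sum T e y (w tau) i = \sum_(t <- r | A t) q t * expR (- u tau i t).
  by rewrite /expmargin_sum big_nat_cond; apply: eq_bigr => t _; exact: zE.
have SS0 := expmargin_sum_gt0 e y T3 (w tau) i.
have kapP t : A t -> c / 8 <= grad_coef T e y (w tau) i t <= C.
  move=> /andP[tT ty]; apply: (grad_coef_bounds T3 yT c0 ddP) => //; first by near: tau.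
  by rewrite mulrC -ler_pdivlMr//; near: tau.
have c80 : 0 < c / 8 by rewrite divr_gt0.
have c8C : c / 8 <= C by lra.
pose D := \sum_(t <- r | Q t) `|hh T e y (w tau) i t - hinf i t|.
have D0 : 0 <= D by apply: sumr_ge0.
have hP t : Q t -> 0 <= hinf i t <= C.
  by move=> /hinfP/andP[h1 ->]; rewrite andbT (le_trans _ h1)// ltW.
have kapD t : Q t -> `|grad_coef T e y (w tau) i t - hinf i t| <=
   D + 3 * C * (\sum_(t <- r | A t) q t * expR (- u tau i t)).
  move=> Qt; have /andP[tT ty] := QA _ Qt; rewrite -SE.
  rewrite -(subrKA (hh T e y (w tau) i t)) addrC; apply: le_trans (ler_normD _ _) _.
  rewrite lerD ?(grad_coef_hh T3 yT c0 ddP)//.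
  rewrite /D (big_rem t) ?mem_index_iota//= Qt lerDl.
  exact: sumr_ge0.
have main : \sum_(t <- r | Q t) hinf i t * p i t * u tau i t *
    (\sum_(s <- r | Q s) p i s * (expR (- (u tau i t + u tau i s)) - 1)) <= 0.
  apply: (symmetrized_drift_le0 (fun t _ => p0 t) _ eps2).
    by move=> t /hinfP/andP[+ _]; exact: lt_le_trans.
  by near: tau; exact: A8.
have SN : \sum_(t <- r | ~~ Q t && A t) q t * expR (- u tau i t) <=
   g tau * \sum_(t <- r | Q t) q t * expR (- u tau i t).
  have := A9 tau; rewrite big_nat_cond.
  rewrite (eq_big (fun t => ~~ Q t && A t) (fun t => q t * expR (- u tau i t))).
  - by under [X in _ <= _ * X -> _]eq_bigr do rewrite zE.
  - by move=> t; rewrite /A andbCA.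
  - by move=> t _; exact: zE.
have := drift_bound c80 c8C QA (fun t _ => p0 t) hP L0 (fun t _ => q0 t) qL qQ kapP
  (erefl K) (erefl B) (g0 tau) SN kapD D0 _ main.
have -> : \sum_(t <- r | A t)
   q t * expR (- u tau i t) * (\sum_(t <- r | A t) q t * expR (- u tau i t)) *
     grad_coef T e y (w tau) i t * u tau i t = \sum_(1 <= t < T | t != y i)
      expmargin e y (w tau) i t * expmargin_sum T e y (w tau) i * grad_coef T e y (w tau) i t * u tau i t.
  by rewrite -SE [RHS]big_nat_cond; apply: eq_bigr => t _; rewrite zE.
rewrite L2 => bound; apply: le_trans (bound _) _; first by rewrite mulr_ge0// ltW.
rewrite lerD2l /beta -mulr_sumr -/D.
have -> : expR (- (3 / 2 * ln tau%:R)) = L * tau%:R^-1.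
  by rewrite -L2 -exprS -expRM_natl; congr expR; field.
have -> : \sum_(t <- r | ~~ Q t && A t) p i t * expR (- ((1 + m t) / 2 * ln tau%:R))
   = L * \sum_(t <- r | ~~ Q t && A t) q t.
  rewrite mulr_sumr; apply: eq_bigr => t _; rewrite /q /L mulrA -expRD [LHS]mulrC.
  by congr (expR _ * _); field.
by rewrite le_eqVlt; apply/orP; left; apply/eqP; ring.
Unshelve. all: by end_near. Qed.

End SampleDrift.

(** * From a bounded remainder to norm and direction *)

Section Asymptotics.
Variables (R : realType) (m : nat).

Lemma normvZ (a : R) (u : 'rV[R]_m) : 0 <= a -> normv (a *: u) = a * normv u.
Proof.
by move=> a0; rewrite /normv dotvZl dotvZr mulrA -expr2 sqrtrM ?sqr_ge0// sqrtr_sqr ger0_norm.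
Qed.

Lemma cvg_normv (v : nat -> 'rV[R]_m) (l : 'rV[R]_m) :
  (forall k, (fun tau => v tau 0 k) @ \oo --> l 0 k) ->
  (fun tau => normv (v tau)) @ \oo --> normv l.
Proof.
move=> vl; apply: (@continuous_cvg _ _ _ _ _ _ (@Num.sqrt R)); first exact: sqrt_continuous.
by rewrite /dotv; apply: cvg_big => [|k _]; [exact: add_continuous|exact: cvgM].
Qed.

Lemma cvg_rV (v : nat -> 'rV[R]_m) (l : 'rV[R]_m) :
  (forall k, (fun tau => v tau 0 k) @ \oo --> l 0 k) -> v @ \oo --> l.
Proof.
move=> vl; apply/cvg_ballP => eps eps0.
have : \forall tau \near \oo, forall k : 'I_m, ball (l 0 k) eps (v tau 0 k).
  by apply: filter_forall => k; have /cvg_ballP := vl k; exact.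
by apply: filterS => tau H; split=> // i j; rewrite ord1; exact: H.
Qed.

Lemma cvg_ln_nat : (fun k : nat => ln (k%:R : R)) @ \oo --> +oo.
Proof.
apply/cvgryPge => a; near=> k.
rewrite -[leLHS]expRK ler_ln ?posrE ?expR_gt0//; first by near: k; exact: nbhs_infty_ger.
by rewrite ltr0n; near: k; exact: nbhs_infty_gt.
Unshelve. all: by end_near. Qed.

Lemma log_growth_asymptotics (w : nat -> 'rV[R]_m) (wh wt : 'rV[R]_m) (M : R)
    (r := fun tau => w tau - (2^-1 * ln tau%:R) *: wh - wt) :
  0 < normv wh ->
  (\forall tau \near \oo, dotv (r tau) (r tau) <= M) ->
  (fun tau => normv (w tau)) ~_\oo (fun tau : nat => normv wh / 2 * ln (tau%:R : R))
  /\ (fun tau => (normv (w tau))^-1 *: w tau) @ \oo --> (normv wh)^-1 *: wh.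
Proof.
move=> wh0 rM.
pose a tau : R := 2^-1 * ln tau%:R.
pose v tau := (a tau)^-1 *: w tau.
have a_infty : a @ \oo --> +oo.
  apply/cvgryPge => B; have /cvgryPge/(_ (2 * B)) := cvg_ln_nat.
  by apply: filterS => tau; rewrite /a; lra.
have a_gt0 : \forall tau \near \oo, 0 < a tau by have /cvgryPgt := a_infty; exact.
have inva : (fun tau => (a tau)^-1) @ \oo --> 0.
  exact/gtr0_cvgV0.
have vk k : (fun tau => v tau 0 k) @ \oo --> wh 0 k.
  have bnd : (fun tau => (a tau)^-1 * (`|wt 0 k| + 1 + M)) @ \oo --> 0.
    by rewrite -(mul0r (`|wt 0 k| + 1 + M)); apply: cvgM inva (cvg_cst _).
  apply/cvgrPdist_le => eps eps0; near=> tau.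
  have a0 : 0 < a tau by near: tau.
  have rMt : dotv (r tau) (r tau) <= M by near: tau.
  (* From (|x| - 1)^2 >= 0 and x^2 <= M, which avoids a square root. *)
  have rk : `|r tau 0 k| <= 1 + M.
    have : r tau 0 k ^+ 2 <= M.
      apply: le_trans rMt; rewrite /dotv (bigD1 k)//= -expr2 lerDl.
      by apply: sumr_ge0 => j _; rewrite -expr2 sqr_ge0.
    have := sqr_ge0 (`|r tau 0 k| - 1); rewrite sqrrB real_normK ?num_real//.
    by have := normr_ge0 (r tau 0 k); rewrite mulr1 expr1n; lra.
  have -> : wh 0 k - v tau 0 k = - ((a tau)^-1 * (wt 0 k + r tau 0 k)).
    rewrite /v /r -/(a tau) !mxE; field; exact: lt0r_neq0.
  rewrite normrN normrM ger0_norm ?invr_ge0 ?(ltW a0)//.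
  apply: (@le_trans _ _ ((a tau)^-1 * (`|wt 0 k| + 1 + M))).
    rewrite ler_wpM2l ?invr_ge0 ?(ltW a0)//.
    by apply: le_trans (ler_normD _ _) _; rewrite -addrA lerD2l.
  apply: le_trans (ler_norm _) _; rewrite -normrN -[X in `|X|]add0r.
  by near: tau; have /cvgrPdist_le := bnd; exact.
have nv := cvg_normv vk.
have nvpos : \forall tau \near \oo, 0 < normv (v tau).
  by have /cvgrPdist_lt/(_ _ wh0) := nv; apply: filterS => tau;
    rewrite ltr_norml => /andP[_]; lra.
have wE tau : 0 < a tau -> normv (w tau) = a tau * normv (v tau).
  move=> a0; rewrite -normvZ ?(ltW a0)// /v scalerA mulfV ?scale1r//.
  exact: lt0r_neq0.
split.
  apply/eqaddoP => eps eps0; near=> tau.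
  have a0 : 0 < a tau by near: tau.
  rewrite !fctE /= wE//.
  have -> : normv wh / 2 * ln tau%:R = a tau * normv wh by rewrite /a; ring.
  rewrite -mulrBr [leLHS]normrM [in leRHS]normrM (gtr0_norm a0) (gtr0_norm wh0) mulrCA ler_pM2l//.
  rewrite distrC; near: tau; have /cvgrPdist_le := nv; apply.
  exact: mulr_gt0.
suff H : (fun tau => (normv (v tau))^-1 *: v tau) @ \oo --> (normv wh)^-1 *: wh.
  apply: cvg_trans H; apply: near_eq_cvg; near=> tau.
  have a0 : 0 < a tau by near: tau.
  have v0 : 0 < normv (v tau) by near: tau.
  rewrite wE// /v scalerA -/(v tau); congr (_ *: _).
  by field; rewrite !lt0r_neq0.
apply: cvg_rV => k; rewrite mxE; under eq_fun do rewrite mxE.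
by apply: cvgM (vk k); apply: cvgV nv; exact: lt0r_neq0.
Unshelve. all: by end_near. Qed.

End Asymptotics.

Theorem theorem3 (R : realType) (n T d : nat)
  (e : 'I_n -> nat -> 'rV[R]_d) (y : 'I_n -> nat) (eta : R)
  (w grad : nat -> 'rV[R]_(d * d))
  (wh : 'rV[R]_(d * d)) (alpha : 'I_n -> nat -> R)
  (hinf : 'I_n -> nat -> R) (wt : 'rV[R]_(d * d)) :
  (1 <= n)%N -> (3 <= T)%N -> (1 <= d)%N ->
  (forall i, (1 <= y i < T)%N) ->
  0 < eta ->
  (* gradient descent on MSE *)
  (forall tau, is_gradient (MSE T e y) (w tau) (grad tau)) ->
  (forall tau, w tau.+1 = w tau - eta *: grad tau) ->
  (* (A1) *)
  hard_margin_solution T e y wh ->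
  (* (A2) *)
  (forall c : 'I_n -> nat -> R, SVcomb T e y wh c = 0 ->
     forall i t, isSV T e y wh i t -> c i t = 0) ->
  wh = SVcomb T e y wh alpha ->
  (* (A3) *)
  (forall i, ~ exists lam : nat -> R,
     (forall t, 0 <= lam t) /\
     \sum_(1 <= t < T | t != y i) lam t = 1 /\
     e i (y i).+1 = \sum_(1 <= t < T | t != y i) lam t *: e i t.+1) ->
  (* (A4) *)
  (forall i t s, (1 <= t < T)%N -> (1 <= s < T)%N -> t != y i -> s != y i ->
     0 < dotv (dd e y i t) (dd e y i s)) ->
  (* (A5) *)
  (fun tau => MSE T e y (w tau)) @ \oo --> 0 ->
  (* (A6) *)
  cvg (series (fun tau => normv (grad tau) ^+ 2) @ \oo) ->
  (* (A7) *)
  (forall i t, (1 <= t < T)%N -> t != y i ->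
     (fun tau => hh T e y (w tau) i t) @ \oo --> hinf i t /\
     cvg (series (fun tau : nat =>
              (tau%:R)^-1 * `|hh T e y (w tau) i t - hinf i t|) @ \oo)) ->
  (* (A8) *)
  in_SVspan T e y wh wt ->
  wtil_eqs T e y eta hinf alpha wh wt ->
  (forall v, in_SVspan T e y wh v -> wtil_eqs T e y eta hinf alpha wh v -> v = wt) ->
  (exists2 eps : R, 0 < eps < 2^-1 &
     \forall tau \near \oo, forall i : 'I_n,
       \sum_(1 <= t < T | isSV T e y wh i t)
         \sum_(1 <= s < T | isSV T e y wh i s && (s != t) &&
                 (Num.sg (HH e y hinf w wh wt tau i t s)
                    != Num.sg (UU e y w wh wt tau i t s)))
           A8term e y hinf w wh wt tau i t s
       <= eps *
       \sum_(1 <= t < T | isSV T e y wh i t)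
         \sum_(1 <= s < T | isSV T e y wh i s && (s != t))
           A8term e y hinf w wh wt tau i t s) ->
  (* (A9) *)
  (exists g : nat -> R,
     cvg (series (fun tau : nat => g tau * (tau%:R)^-1) @ \oo) /\
     forall (i : 'I_n) (tau : nat),
       \sum_(1 <= s < T | ~~ isSV T e y wh i s && (s != y i))
          expR (- dotv (w tau) (xtil e y i s))
       <= g tau * \sum_(1 <= s < T | isSV T e y wh i s)
                    expR (- dotv (w tau) (xtil e y i s))) ->
  (* conclusion *)
  (fun tau => normv (w tau)) ~_\oo (fun tau : nat => normv wh / 2 * ln (tau%:R : R))
  /\ (fun tau => (normv (w tau))^-1 *: w tau) @ \oo --> (normv wh)^-1 *: wh.
Proof.
move=> n1 T3 d1 yT eta0 grad_w gd [feas _] _ whE _ A4 A5 A6 A7 _ wtE _.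
move=> [eps /andP[_ eps2] A8] [g [gcv A9]].
pose r := rr w wh wt.
pose sq tau := expR (- (2 * ln (tau%:R : R))).
pose drift i tau := \sum_(1 <= t < T | t != y i)
  expmargin e y (w tau) i t * expmargin_sum T e y (w tau) i * grad_coef T e y (w tau) i t
  * dotv (r tau) (xtil e y i t).
pose M i tau := (\sum_(1 <= t < T | isSV T e y wh i t)
    hinf i t * pp e y wt i t * dotv (r tau) (xtil e y i t))
  * \sum_(1 <= t < T | isSV T e y wh i t) pp e y wt i t.
(* S > 0 and (A9) force the support part of S to be positive, so g is a quotient bound from above
   for a nonnegative ratio. Convergence of its series then means summability. *)
have g0 tau : 0 <= g tau.
  pose i0 := Ordinal n1; have := A9 i0 tau.
  set X := \sum_(_ <= _ < _ | _) _; set Y := \sum_(_ <= _ < _ | _) _ => XgY.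
  have X0 : 0 <= X by apply: sumr_ge0 => t _; exact: expR_ge0.
  have Y0 : 0 <= Y by apply: sumr_ge0 => t _; exact: expR_ge0.
  have SXY : expmargin_sum T e y (w tau) i0 = Y + X.
    rewrite /expmargin_sum (bigID (isSV T e y wh i0))/=; congr (_ + _).
      by apply: eq_bigl => t; apply/andb_idl => /and3P[].
    by apply: eq_bigl => t; exact: andbC.
  have S0 := expmargin_sum_gt0 e y T3 (w tau) i0.
  have Ypos : 0 < Y.
    rewrite lt_neqAle Y0 andbT eq_sym; apply/eqP => YE.
    by move: XgY S0; rewrite SXY YE mulr0; lra.
  by rewrite -(pmulr_lge0 _ Ypos); exact: le_trans XgY.
have gsum : nneg_summable (fun tau : nat => g tau * tau%:R^-1).
  by apply: nneg_summable_series gcv => k; rewrite mulr_ge0// invr_ge0.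
have : forall i, exists beta, nneg_summable beta /\ \forall tau \near \oo,
    drift i tau <= tau%:R^-1 * M i tau + beta tau.
  move=> i.
  pose A t := (1 <= t < T)%N && (t != y i).
  have [c [C /andP[c0 _] ddP]] := @pos_family_bounds R _
    [seq (t, s) | t <- index_iota 1 T, s <- index_iota 1 T]
    (fun ts => A ts.1 && A ts.2) (fun ts => dotv (dd e y i ts.1) (dd e y i ts.2))
    (fun ts => ltac:(by case/andP => /andP[a1 a2] /andP[b1 b2]; exact: A4)).
  have dP t s : (1 <= t < T)%N -> t != y i -> (1 <= s < T)%N -> s != y i ->
     c <= dotv (dd e y i t) (dd e y i s) <= C.
    move=> tT ty sT sy; apply: (ddP (t, s)); last by rewrite /A tT ty sT.
    by rewrite allpairs_f// mem_index_iota.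
  have [|beta bsum bnear] := sample_drift T3 yT c0 dP feas A5 (A7 i) eps2 g0 gsum (A9 i) (wt := wt).
    by apply: filterS A8 => tau; exact.
  by exists beta.
move=> /choice[beta betaP].
pose gam tau := 2 * eta * (\sum_(i < n) beta i tau) + (1 + dotv wh wh) * sq tau
  + 2 * eta ^+ 2 * normv (grad tau) ^+ 2.
have gamsum : nneg_summable gam.
  apply: nneg_summableD.
    apply: nneg_summableD.
      apply: nneg_summableZ; first by rewrite mulr_ge0// ltW.
      by apply: nneg_summable_sum => i _; have [] := betaP i.
    apply: nneg_summableZ; first by rewrite addr_ge0// dotvv_ge0.
    by apply: nneg_summable_ln; lra.
  apply: nneg_summableZ; first by rewrite mulr_ge0// sqr_ge0.
  by apply: nneg_summable_series A6 => k; exact: sqr_ge0.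
(* The summand 1 lets additive summable errors be absorbed as relative ones, since V >= 1. *)
pose V tau := 1 + dotv (r tau) (r tau).
have V1 tau : 1 <= V tau by rewrite lerDl dotvv_ge0.
(* The defining equations of [wt] read alpha_t = 2 eta h_t p_t sum_s p_s. Hence the drift of the
   schedule matches the leading term of the gradient, and only its mismatch 1/tau - l is left. *)
have wh_r tau : dotv wh (r tau) = 2 * eta * \sum_(i < n) M i tau.
  rewrite [X in dotv X _]whE /SVcomb dotv_suml mulr_sumr; apply: eq_bigr => i _.
  rewrite dotv_suml /M mulr_suml mulr_sumr; apply: eq_bigr => t SVt.
  rewrite dotvZl dotvC.
  have -> : alpha i t = 2 * (2^-1 * alpha i t) by rewrite mulVKf// pnatr_eq0.
  rewrite -wtE// /pp; ring.
have step : \forall tau \near \oo, V tau.+1 <= (1 + gam tau) * V tau.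
  near=> tau.
  have bt : forall i, drift i tau <= tau%:R^-1 * M i tau + beta i tau.
    by near: tau; apply: filter_forall => i; have [] := betaP i.
  have tau1 : (0 < tau)%N by near: tau; exact: nbhs_infty_gt.
  pose l := ln (tau.+1%:R : R) - ln tau%:R.
  pose D := - (eta *: grad tau) - (2^-1 * l) *: wh.
  have rD : r tau.+1 = r tau + D.
    by apply/rowP => k; rewrite /r /rr /D /l gd !mxE; ring.
  have Dr : 2 * dotv D (r tau) <= 2 * eta * (\sum_(i < n) beta i tau) +
     (tau%:R^-1 - l) * dotv wh (r tau).
    have gr : - dotv (grad tau) (r tau) <=
        tau%:R^-1 * (\sum_(i < n) M i tau) + \sum_(i < n) beta i tau.
      rewrite (MSE_gradient T3 yT (grad_w tau)) dotvNl opprK dotv_suml mulr_sumr -big_split/=.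
      apply: ler_sum => i _; apply: le_trans (bt i).
      rewrite dotv_suml le_eqVlt; apply/orP; left; apply/eqP; apply: eq_bigr => t _.
      by rewrite dotvZl [dotv (xtil _ _ _ _) _]dotvC.
    rewrite wh_r /D dotvBl dotvNl !dotvZl wh_r.
    have : eta * - dotv (grad tau) (r tau) <= eta * (tau%:R^-1 * (\sum_(i < n) M i tau) + \sum_(i < n) beta i tau).
      by rewrite ler_pM2l.
    set x := tau%:R^-1; set N := \sum_(i < n) M i tau; set y0 := \sum_(i < n) beta i tau; set G := dotv (grad tau) _.
    move=> H.
    have -> : 2 * (- (eta * G) - 2^-1 * l * (2 * eta * N)) = 2 * (eta * - G) - l * (2 * eta * N) by field.
    have -> : 2 * eta * y0 + (x - l) * (2 * eta * N) = 2 * (eta * (x * N + y0)) - l * (2 * eta * N) by ring.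
    lra.
  have l0 : 0 <= l by rewrite subr_ge0 ler_ln ?posrE ?ltr0n// ler_nat.
  have /andP[lx lsq] := @ln_succ_sub R _ tau1; rewrite -/l in lx lsq.
  have sqE : sq tau = tau%:R^-1 ^+ 2.
    have tau0 : 0 < tau%:R :> R by rewrite ltr0n.
    by rewrite /sq -[in RHS](lnK tau0) -expRN -expRM_natl mulrN.
  have DD : dotv D D <= 2 * eta ^+ 2 * normv (grad tau) ^+ 2 + 2^-1 * sq tau * dotv wh wh.
    rewrite /D dotvvD.
    have := dotv_young (- ((2^-1 * l) *: wh)) (- (eta *: grad tau)).
    move=> /(le_trans (ler_norm _)) Y.
    have AA : dotv (- (eta *: grad tau)) (- (eta *: grad tau)) = eta ^+ 2 * normv (grad tau) ^+ 2.
      by rewrite dotvNl dotvC dotvNl dotvZl dotvZr normv_sqr; ring.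
    have BB : dotv (- ((2^-1 * l) *: wh)) (- ((2^-1 * l) *: wh)) = 4^-1 * (l ^+ 2 * dotv wh wh).
      by rewrite dotvNl dotvC dotvNl dotvZl dotvZr; field.
    have : l ^+ 2 * dotv wh wh <= sq tau * dotv wh wh.
      by rewrite ler_wpM2r ?dotvv_ge0// sqE ler_sqr ?nnegrE ?invr_ge0//; lra.
    rewrite AA BB in Y *; lra.
  (* The mismatch is O(tau^(-2)); Young's inequality makes it a summable multiple of |wh|^2 + |r|^2,
     without any prior bound on r. *)
  have cross : 2 * ((tau%:R^-1 - l) * dotv wh (r tau)) <=
      sq tau * (dotv wh wh + dotv (r tau) (r tau)).
    rewrite mulrCA; apply: (@le_trans _ _ (`|(tau%:R^-1 - l) * (2 * dotv wh (r tau))|)).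
      exact: ler_norm.
    by rewrite normrM (ger0_norm lx) sqE; apply: ler_pM => //; exact: dotv_young.
  have [gb gg] : 0 <= 2 * eta * (\sum_(i < n) beta i tau) /\
      0 <= 2 * eta ^+ 2 * normv (grad tau) ^+ 2.
    split; last by rewrite mulr_ge0 ?sqr_ge0// mulr_ge0 ?sqr_ge0.
    by rewrite !mulr_ge0 ?(ltW eta0)// sumr_ge0// => i _; have [[]] := betaP i.
  have sq0 : 0 <= sq tau := expR_ge0 _.
  have Z0 := dotvv_ge0 (r tau); have W0 := dotvv_ge0 wh.
  rewrite mulrDl mul1r /gam !mulrDl mul1r {1}/V rD dotvvD.
  have pb := ler_peMr gb (V1 tau); have pg := ler_peMr gg (V1 tau).
  have sqV : sq tau * V tau = sq tau + sq tau * dotv (r tau) (r tau) by rewrite /V; ring.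
  have sqZ0 : 0 <= sq tau * dotv (r tau) (r tau) by rewrite mulr_ge0.
  have sqW0 : 0 <= sq tau * dotv wh wh by rewrite mulr_ge0.
  have sqWV : sq tau * dotv wh wh <= dotv wh wh * sq tau * V tau.
    by rewrite [dotv wh wh * _]mulrC ler_peMr.
  rewrite mulrDr in cross.
  have VE : V tau = 1 + dotv (r tau) (r tau) by [].
  lra.
have [k0 _ stepP] := step.
have [B VB] := perturbed_nonincreasing_bounded (fun k => le_trans ler01 (V1 k)) gamsum stepP.
have wh0 : 0 < normv wh.
  pose i0 := Ordinal n1.
  have [t t1 t2] := exists_nonmatch (y i0) T3.
  apply: (@normv_gt0 _ _ _ (xtil e y i0 t)).
  by rewrite gt_eqF// (lt_le_trans ltr01)// feas.
apply: (@log_growth_asymptotics _ _ _ _ wt B wh0).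
near=> tau; apply: (@le_trans _ _ (V tau)); first by rewrite /V lerDr.
by apply: VB; near: tau; exact: nbhs_infty_ge.
Unshelve. all: by end_near. Qed.
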